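(* If $|\nu|\leq\frac12$, then the Hadamard factorization of the real entire function $\mathcal{H}_\nu:\mathbb{R}\to(-\infty,1]$, defined by $$\mathcal{H}_{\nu}(x)=\sqrt{\pi}\,2^{\nu}x^{-\nu-1}\Gamma\left(\nu+\tfrac{3}{2}\right)\mathbf{H}_{\nu}(x),$$ reads as follows: $$\mathcal{H}_{\nu}(x)=\prod_{n\geq 1}\left(1-\frac{x^2}{h_{\nu,n}^2}\right),$$ where $h_{\nu,n}$ stands for the $n$th positive zero of the Struve function $\mathbf{H}_\nu$. This infinite product is absolutely convergent, and if $|\nu|\leq \frac12$ and $x\neq h_{\nu,n}$, $n\in\{1,2,\dots\}$, then the Mittag-Leffler expansion of the Struve function $\mathbf{H}_\nu$ is as follows: $$\frac{\mathbf{H}_{\nu-1}(x)}{\mathbf{H}_{\nu}(x)}=\frac{2\nu+1}{x}+\sum_{n\geq1}\frac{2x}{x^2-h_{\nu,n}^2}.$$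
   Context: Here $\nu$ is real and $\mathbf{H}_\nu$ is the Struve function of the first kind, $$\mathbf{H}_{\nu}(x)=\left(\frac{x}{2}\right)^{\nu+1}\sum_{n\geq0}\frac{(-1)^n\left(\frac{x}{2}\right)^{2n}}{\Gamma\left(n+\frac{3}{2}\right)\Gamma\left(n+\nu+\frac{3}{2}\right)},$$ where $1/\Gamma$ is taken to be $0$ at the non-positive integers. The function $\mathcal{H}_\nu$ is understood on all of $\mathbb{R}$ through its even power series $$\mathcal{H}_\nu(x)=\frac{\sqrt{\pi}}{2}\sum_{n\geq0}\frac{(-1)^n\,\Gamma\left(\nu+\frac32\right)x^{2n}}{2^{2n}\,\Gamma\left(n+\frac32\right)\Gamma\left(n+\nu+\frac32\right)}.$$ The Mittag-Leffler expansion is understood for real $x$ at which both sides are defined, so that $x\ne0$ and $x\neq-h_{\nu,n}$ as well; for $x<0$ the quotient on the left is read by cancelling the powers of $x/2$, i.e. as $\frac{2}{x}$ times the quotient of the two power series (without the power prefactors) of $\mathbf{H}_{\nu-1}$ and $\mathbf{H}_\nu$. *)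

(* Defs.v *)
From Stdlib Require Import Reals List ZArith.
From Coquelicot Require Import Coquelicot.

Local Open Scope R_scope.

(** * The Gamma function on the real line *)

Definition Gamma_int (x : R) : R :=
  RInt_gen (fun t => Rpower t (x - 1) * exp (- t))
           (at_right 0) (Rbar_locally p_infty).

(* x (x + 1) ... (x + k - 1) *)
Fixpoint rising (x : R) (k : nat) : R :=
  match k with
  | O => 1
  | S j => rising x j * (x + INR j)
  end.

(* A number of unit shifts bringing [x] into the domain of the Euler integral:
   x + INR (Gamma_shift x) > 0 for all x, and Gamma_shift x = 0 whenever x > 0. *)
Definition Gamma_shift (x : R) : nat := Z.to_nat (up (- x)).

(* Extension of the Euler integral by Gamma (x + 1) = x * Gamma x; a junk value
   at the poles 0, -1, -2, ... *)
Definition Gamma (x : R) : R :=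
  Gamma_int (x + INR (Gamma_shift x)) / rising x (Gamma_shift x).

(* 1 / Gamma on the whole line: at x = 0, -1, -2, ... the factor
   [rising x (Gamma_shift x)] vanishes, so that the value is 0 there. *)
Definition rGamma (x : R) : R :=
  rising x (Gamma_shift x) / Gamma_int (x + INR (Gamma_shift x)).

(** * Struve functions of the first kind *)

Definition struve_series (nu x : R) : R :=
  Series (fun n => (-1) ^ n * (x / 2) ^ (2 * n)
                   * rGamma (INR n + 3 / 2) * rGamma (INR n + nu + 3 / 2)).

(* Meaningful for x > 0 only, because of [Rpower]. *)
Definition struve (nu x : R) : R :=
  Rpower (x / 2) (nu + 1) * struve_series nu x.

(* H_{nu-1} (x) / H_nu (x). For x < 0 the powers of x / 2 are cancelled formally:
   (x/2)^nu / (x/2)^(nu+1) = 2 / x. *)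
Definition struve_quotient (nu x : R) : R :=
  if Rlt_dec 0 x then struve (nu - 1) x / struve nu x
  else 2 / x * (struve_series (nu - 1) x / struve_series nu x).

Definition calH_term (nu x : R) (n : nat) : R :=
  (-1) ^ n * Gamma (nu + 3 / 2) * x ^ (2 * n) / 2 ^ (2 * n)
  * rGamma (INR n + 3 / 2) * rGamma (INR n + nu + 3 / 2).

Definition calH (nu x : R) : R := sqrt PI / 2 * Series (calH_term nu x).

(** * Enumeration of positive zeros *)

(* For f smooth near x; m = 0 means f x <> 0. *)
Definition vanishing_order (f : R -> R) (x : R) (m : nat) : Prop :=
  (forall k, (k < m)%nat -> Derive_n f k x = 0) /\ Derive_n f m x <> 0.

(* [h] lists the positive zeros of [f] in nondecreasing order, each one repeated
   according to its multiplicity; [h n] is the (n+1)-th positive zero.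
   Multiplicities matter: up to a nonvanishing factor H_{1/2} (x) is 1 - cos x,
   all of whose zeros are double. *)
Definition positive_zeros (f : R -> R) (h : nat -> R) : Prop :=
  (forall n, 0 < h n) /\
  (forall n, h n <= h (S n)) /\
  (forall x, 0 < x ->
     exists m, vanishing_order f x m /\
       exists l : list nat,
         NoDup l /\ length l = m /\ forall n, In n l <-> h n = x).

(** * Infinite products *)

Definition is_inf_prod (u : nat -> R) (l : R) : Prop :=
  is_lim_seq (fun N => prod_f_R0 u N) l.

(* Absolute convergence of prod (1 + a n) is convergence of prod (1 + |a n|);
   the limit of the latter is at least 1, hence never the degenerate value 0. *)
Definition inf_prod_abs_cv (a : nat -> R) : Prop :=
  exists l : R, is_inf_prod (fun n => 1 + Rabs (a n)) l.

(* Main.v *)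
Require Import Defs.
From Stdlib Require Import Reals List ZArith Lra Lia ClassicalEpsilon.
From Coquelicot Require Import Coquelicot.

(** Put [lam = nu + 1 / 2], which lies in [0, 1]. The recurrence of Gamma and the
    value [Gamma (1 / 2) = sqrt PI] rewrite [calH nu x] as
<<
    hyp lam x = sum_m (-1)^m x^(2m) / (2m+1)! * m! / ((lam+1)...(lam+m)).
>>
    For [lam > 0] this is, up to a factor, the integral of
    [(1 - t^2)^(lam - 1) * sin (x t) / x] over [0 < t < 1], whose weight is
    nondecreasing in [t]. Polya observed that a sine
    transform with increasing weight has only real zeros, because a sine polynomial
    with increasing coefficients changes sign as often as its degree permits. The
    proof follows this idea with real numbers only. Neither complex zeros nor
    growth of entire functions appear, since the factorization is already present at
    the level of polynomials and survives a limit.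

    For [0 < lam < 1] the integral is replaced by the sum over [x <= N] of
    [weight lam N x * sin ((2 x + 1) th)], where the weights are, up to
    a common factor, products of two Taylor coefficients of [(1 - z)^(- lam)], like
    the coefficients of the Gegenbauer polynomials. They increase in [x] ([weight_incr]), and their moments against
    the central factorials are known exactly ([moment_S]). As the central factorials are also the
    coefficients of [sin ((2 x + 1) th)] in powers of [sin th]
    ([odd_sine_correct]), the sum equals
    [sin th * approx lam N (sin th ^ 2)] with [approx lam N] an explicit polynomial of
    degree [N] ([approx_sine_sum]). Abel summation determines its sign at the
    [N + 1] points [node N m] ([approx_sign]), so it has a root between any two
    consecutive ones and is the product of the corresponding linear factors
    ([approx_factorization]).

    With [th = x / (2 (N + 1))] and [N] tending to infinity, the polynomials tend to
    [hyp lam x] ([approx_lim]), also for [lam = 0] and [lam = 1] if the parameter is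
    moved along with [N]. The rescaled roots stay between consecutive multiples of
    [PI], so they have a common cluster point [h], and Tannery's theorem for products
    gives [hyp lam x] as the product of the [1 - x^2 / h_j^2]
    ([hyp_factorization]). The bound [calH nu x <= 1] is inherited from the sums,
    which are averages of [sin (k th) / (k sin th)].

    It remains to recognize [h]. The product shows that near [a > 0] the function is
    comparable to [|x - a|^m], with [m] the number of indices [j] such that
    [h_j = a] ([product_comparable_power]); for a smooth function this means
    vanishing of order [m] ([vanishing_order_comparable]). So [h] enumerates the
    zeros, and a nondecreasing enumeration with given multiplicities is unique
    ([positive_zeros_unique]). Finally, the recurrence of [1 / Gamma] expresses the
    series of index [nu - 1] by that of index [nu] and its derivative
    ([struve_series_pred]), and the logarithmic derivative of the product
    ([product_is_derive]) yields the Mittag-Leffler expansion. *)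

Local Open Scope R_scope.

(** * Improper integrals over the positive half-line *)

Lemma derivable_continuous (f : R -> R) (x : R) : ex_derive f x -> continuous f x.
Proof. exact (ex_derive_continuous f x). Qed.

Lemma ball_R (x e y : R) : ball x e y -> x - e < y < x + e.
Proof.
  intros H. change (Rabs (y - x) < e) in H. apply Rabs_lt_between in H. lra.
Qed.

Lemma exp_le_mono (x y : R) : x <= y -> exp x <= exp y.
Proof.
  intros [H| ->]; [apply Rlt_le, exp_increasing, H|apply Rle_refl].
Qed.

Lemma filter_prod_pos (P : R -> Prop) :
  (forall t, 0 < t -> P t) ->
  filter_prod (at_right 0) (Rbar_locally p_infty)
    (fun ab => forall x, Rmin (fst ab) (snd ab) <= x <= Rmax (fst ab) (snd ab) -> P x).
Proof.
  intros HP.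
  apply Filter_prod with (fun a => 0 < a) (fun b => 0 < b).
  - exists (mkposreal 1 Rlt_0_1); intros y _ Hy; exact Hy.
  - exists 0; intros y Hy; exact Hy.
  - intros a b Ha Hb x [Hx _]; simpl in *.
    apply HP. apply Rlt_le_trans with (2 := Hx). apply Rmin_glb_lt; assumption.
Qed.

Lemma is_RInt_gen_pos_ext (f g : R -> R) (l : R) :
  (forall t, 0 < t -> f t = g t) ->
  is_RInt_gen f (at_right 0) (Rbar_locally p_infty) l ->
  is_RInt_gen g (at_right 0) (Rbar_locally p_infty) l.
Proof.
  intros Hfg. apply is_RInt_gen_ext.
  generalize (filter_prod_pos (fun t => f t = g t) Hfg).
  apply filter_imp. intros ab H x Hx. apply H. lra.
Qed.

Lemma is_RInt_gen_antiderivative (F f : R -> R) (la lb : R) :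
  (forall t, 0 < t -> is_derive F t (f t)) ->
  (forall t, 0 < t -> continuous f t) ->
  filterlim F (at_right 0) (locally la) ->
  filterlim F (Rbar_locally p_infty) (locally lb) ->
  is_RInt_gen f (at_right 0) (Rbar_locally p_infty) (lb - la).
Proof.
  intros HF Hc Ha Hb.
  apply is_RInt_gen_pos_ext with (Derive F).
  { intros t Ht. apply is_derive_unique, HF, Ht. }
  apply is_RInt_gen_Derive; try assumption.
  - apply filter_prod_pos. intros t Ht. exists (f t). apply HF, Ht.
  - apply filter_prod_pos. intros t Ht.
    apply continuous_ext_loc with (2 := Hc t Ht).
    exists (mkposreal t Ht). intros y Hy.
    symmetry. apply is_derive_unique, HF.
    apply ball_R in Hy. simpl in Hy. lra.
Qed.

Lemma is_RInt_gen_pos_le (f g : R -> R) (lf lg : R) :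
  (forall t, 0 < t -> f t <= g t) ->
  is_RInt_gen f (at_right 0) (Rbar_locally p_infty) lf ->
  is_RInt_gen g (at_right 0) (Rbar_locally p_infty) lg -> lf <= lg.
Proof.
  intros Hfg Hf Hg.
  assert (H := is_RInt_gen_minus g f lg lf Hg Hf).
  assert (H0 : is_RInt_gen (fun t => minus (g t) (f t)) (at_right 0)
                 (Rbar_locally p_infty) (minus lg lf)) by exact H.
  assert (K : norm (minus lg lf) <= minus lg lf).
  { apply (RInt_gen_norm (Fa := at_right 0) (Fb := Rbar_locally p_infty)
             (fun t => minus (g t) (f t)) (fun t => minus (g t) (f t))); try assumption.
    - apply Filter_prod with (fun a => a < 1) (fun b => 1 < b).
      + exists (mkposreal 1 Rlt_0_1); intros y Hy _.
        apply ball_R in Hy. simpl in Hy. lra.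
      + exists 1; intros y Hy; exact Hy.
      + intros a b Ha Hb; simpl; lra.
    - apply Filter_prod with (fun a => 0 < a) (fun b => 0 < b).
      + exists (mkposreal 1 Rlt_0_1); intros y _ Hy; exact Hy.
      + exists 0; intros y Hy; exact Hy.
      + intros a b Ha Hb x Hx; simpl in *.
        unfold norm; simpl; unfold abs; simpl.
        rewrite Rabs_pos_eq; [apply Rle_refl|].
        unfold minus, plus, opp; simpl. specialize (Hfg x). lra. }
  unfold norm, minus, plus, opp in K; simpl in K; unfold abs in K; simpl in K.
  pose proof (Rabs_pos (lg + - lf)). lra.
Qed.

Lemma ex_RInt_pos (f : R -> R) (a b : R) :
  (forall t, 0 < t -> continuous f t) -> 0 < a -> 0 < b -> ex_RInt f a b.
Proof.
  intros Hc Ha Hb. apply (ex_RInt_continuous (V := R_CompleteNormedModule)).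
  intros z Hz. apply Hc. apply Rlt_le_trans with (2 := proj1 Hz).
  apply Rmin_glb_lt; assumption.
Qed.

(** The integrals over [a, b] increase when the interval grows, so their supremum is
    the improper integral. *)
Lemma is_RInt_gen_bounded (f : R -> R) (M : R) :
  (forall t, 0 < t -> continuous f t) ->
  (forall t, 0 < t -> 0 <= f t) ->
  (forall a b, 0 < a -> a < b -> RInt f a b <= M) ->
  exists l, is_RInt_gen f (at_right 0) (Rbar_locally p_infty) l.
Proof.
  intros Hc H0 HM.
  destruct (completeness (fun v => exists a b, 0 < a /\ a < b /\ v = RInt f a b))
    as [l [Hub Hlub]].
  - exists M. intros v (a & b & Ha & Hab & ->). apply HM; assumption.
  - exists (RInt f 1 2), 1, 2. repeat split; lra.
  - assert (Hle : forall a b, 0 < a -> a < b -> RInt f a b <= l).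
    { intros a b Ha Hab. apply Hub. exists a, b. auto. }
    exists l. intros P [eps Heps].
    assert (Hex : exists a b, 0 < a /\ a < b /\ l - eps < RInt f a b).
    { apply Classical_Prop.NNPP. intros Hn.
      assert (l <= l - eps).
      { apply Hlub. intros v (a & b & Ha & Hab & ->).
        apply Rnot_lt_le. intros Hlt. apply Hn. exists a, b. auto. }
      destruct eps as [e He]; simpl in *; lra. }
    destruct Hex as (a0 & b0 & Ha0 & Hab0 & Hl).
    apply Filter_prod with (fun a => 0 < a < a0) (fun b => b0 < b).
    + exists (mkposreal a0 Ha0). intros y Hy Hy0.
      apply ball_R in Hy. simpl in Hy. lra.
    + exists b0; auto.
    + intros a b [Ha Haa] Hb. exists (RInt f a b). simpl. split.
      { apply (RInt_correct (V := R_CompleteNormedModule)).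
        apply ex_RInt_pos; auto; lra. }
      apply Heps.
      assert (H1 : RInt f a b = RInt f a a0 + RInt f a0 b0 + RInt f b0 b).
      { rewrite <- (RInt_Chasles f a a0 b) by (apply ex_RInt_pos; auto; lra).
        rewrite <- (RInt_Chasles f a0 b0 b) by (apply ex_RInt_pos; auto; lra).
        unfold plus; simpl. ring. }
      assert (H2 : 0 <= RInt f a a0).
      { apply RInt_ge_0; [lra|apply ex_RInt_pos; auto; lra|]. intros; apply H0; lra. }
      assert (H3 : 0 <= RInt f b0 b).
      { apply RInt_ge_0; [lra|apply ex_RInt_pos; auto; lra|]. intros; apply H0; lra. }
      assert (H4 := Hle a b ltac:(lra) ltac:(lra)).
      change (Rabs (RInt f a b - l) < eps).
      apply Rabs_lt_between. lra.
Qed.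

Lemma continuous_at_right (f : R -> R) (a : R) :
  continuous f a -> filterlim f (at_right a) (locally (f a)).
Proof.
  intros Hf. apply (filterlim_filter_le_1 (F := locally a)); [|exact Hf].
  apply (filter_le_within (F := locally a)).
Qed.

(** * The Gamma integral: existence, recurrence and positivity *)

Definition gamma_density (x t : R) : R := Rpower t (x - 1) * exp (- t).

Lemma continuous_gamma_density x t : 0 < t -> continuous (gamma_density x) t.
Proof.
  intros Ht. apply derivable_continuous. unfold gamma_density, Rpower.
  auto_derive. exact Ht.
Qed.

Lemma gamma_density_pos x t : 0 < gamma_density x t.
Proof. unfold gamma_density, Rpower. apply Rmult_lt_0_compat; apply exp_pos. Qed.

Lemma gamma_density_S x t :
  0 < t -> gamma_density (x + 1) t = t * gamma_density x t.
Proof.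
  intros Ht. unfold gamma_density.
  replace (x + 1 - 1) with (1 + (x - 1)) by ring.
  rewrite Rpower_plus, Rpower_1 by assumption. ring.
Qed.

Lemma filterlim_gamma_density_0 x :
  1 < x -> filterlim (gamma_density x) (at_right 0) (locally 0).
Proof.
  intros Hx. unfold gamma_density.
  replace 0 with (0 * exp (- 0)) at 2 by ring.
  apply (filterlim_comp_2 (G := locally 0) (H := locally (exp (- 0)))).
  - unfold Rpower. apply filterlim_comp with (Rbar_locally m_infty).
    + apply filterlim_comp with (Rbar_locally m_infty); [apply is_lim_ln_0|].
      intros P [M HM]. exists (M / (x - 1)). intros y Hy. apply HM.
      apply Rmult_lt_compat_l with (r := x - 1) in Hy; [|lra].
      replace ((x - 1) * (M / (x - 1))) with M in Hy by (field; lra). exact Hy.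
    + exact is_lim_exp_m.
  - apply (continuous_at_right (fun t => exp (- t))).
    apply derivable_continuous. auto_derive. exact I.
  - apply (filterlim_mult 0 (exp (- 0))).
Qed.

Lemma filterlim_gamma_density_infty x :
  filterlim (gamma_density x) (Rbar_locally p_infty) (locally 0).
Proof.
  unfold gamma_density, Rpower.
  apply filterlim_ext_loc with (fun t => exp (t * ((x - 1) * (ln t / t) + -1))).
  { exists 0. intros t Ht. rewrite <- exp_plus. f_equal. field. lra. }
  apply filterlim_comp with (Rbar_locally m_infty); [|exact is_lim_exp_m].
  change (is_lim (fun t => t * ((x - 1) * (ln t / t) + -1)) p_infty m_infty).
  assert (E : is_Rbar_mult p_infty (-1) m_infty).
  { apply is_Rbar_mult_p_infty_neg. simpl. lra. }
  rewrite <- (is_Rbar_mult_unique _ _ _ E).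
  apply is_lim_mult.
  - apply is_lim_id.
  - replace (Finite (-1)) with (Rbar_plus (Finite ((x - 1) * 0)) (Finite (-1)))
      by (simpl; f_equal; ring).
    apply is_lim_plus'; [|apply is_lim_const].
    apply is_lim_scal_l with (l := Finite 0). apply is_lim_div_ln_p.
  - simpl. lra.
Qed.

(** Integration by parts: the integrand is the derivative of
    [t ^ x * exp (- t)], which vanishes at both ends. Convergence for [x] and for
    [x + 1] are therefore equivalent. *)
Lemma is_RInt_gen_gamma_parts x :
  0 < x ->
  is_RInt_gen (fun t => x * gamma_density x t - gamma_density (x + 1) t)
    (at_right 0) (Rbar_locally p_infty) 0.
Proof.
  intros Hx. replace 0 with (0 - 0) at 2 by ring.
  apply is_RInt_gen_antiderivative with (gamma_density (x + 1)).
  - intros t Ht. rewrite (gamma_density_S x t Ht). unfold gamma_density, Rpower.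
    auto_derive; [exact Ht|].
    replace ((x + 1 - 1) * ln t) with (ln t + (x - 1) * ln t) by ring.
    rewrite exp_plus, exp_ln by assumption. field. lra.
  - intros t Ht. apply (continuous_minus (V := R_NormedModule)).
    + apply (continuous_scal_r (V := R_NormedModule) x).
      apply continuous_gamma_density, Ht.
    + apply continuous_gamma_density, Ht.
  - apply filterlim_gamma_density_0. lra.
  - apply filterlim_gamma_density_infty.
Qed.

Lemma is_RInt_gen_gamma_up x l :
  0 < x ->
  is_RInt_gen (gamma_density x) (at_right 0) (Rbar_locally p_infty) l ->
  is_RInt_gen (gamma_density (x + 1)) (at_right 0) (Rbar_locally p_infty) (x * l).
Proof.
  intros Hx Hl.
  assert (H := is_RInt_gen_minus _ _ _ _
                 (is_RInt_gen_scal _ x _ Hl) (is_RInt_gen_gamma_parts x Hx)).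
  replace (x * l) with (minus (scal x l) 0)
    by (unfold minus, plus, opp, scal; simpl; unfold mult; simpl; ring).
  revert H. apply is_RInt_gen_pos_ext. intros t Ht.
  unfold minus, plus, opp, scal; simpl; unfold mult; simpl. ring.
Qed.

Lemma is_RInt_gen_gamma_down x l :
  0 < x ->
  is_RInt_gen (gamma_density (x + 1)) (at_right 0) (Rbar_locally p_infty) l ->
  is_RInt_gen (gamma_density x) (at_right 0) (Rbar_locally p_infty) (l / x).
Proof.
  intros Hx Hl.
  assert (H := is_RInt_gen_scal _ (/ x) _
                 (is_RInt_gen_plus _ _ _ _ Hl (is_RInt_gen_gamma_parts x Hx))).
  replace (l / x) with (scal (/ x) (plus l 0))
    by (unfold plus, scal; simpl; unfold mult; simpl; field; lra).
  revert H. apply is_RInt_gen_pos_ext. intros t Ht.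
  unfold plus, scal; simpl; unfold mult; simpl. field. lra.
Qed.

(** On this range [t ^ (x - 1) <= 1 + t], and [(1 + t) * exp (- t)] has an
    elementary antiderivative. *)
Lemma ex_gamma_1_2 x :
  1 <= x <= 2 ->
  exists l, is_RInt_gen (gamma_density x) (at_right 0) (Rbar_locally p_infty) l.
Proof.
  intros Hx.
  apply (is_RInt_gen_bounded (gamma_density x) 2).
  - intros t Ht. apply continuous_gamma_density, Ht.
  - intros t Ht. apply Rlt_le, gamma_density_pos.
  - intros a b Ha Hab.
    assert (Hi : is_RInt (fun t => (1 + t) * exp (- t)) a b
                   ((- (2 + b) * exp (- b)) - (- (2 + a) * exp (- a)))).
    { apply (is_RInt_derive (fun t => - (2 + t) * exp (- t))).
      - intros t _. auto_derive; [exact I|]. ring.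
      - intros t _. apply derivable_continuous. auto_derive. exact I. }
    apply Rle_trans with (RInt (fun t => (1 + t) * exp (- t)) a b).
    + apply RInt_le; [lra| | |].
      * apply ex_RInt_pos; [|lra|lra]. intros t Ht. apply continuous_gamma_density, Ht.
      * eexists; exact Hi.
      * intros t Ht. unfold gamma_density. apply Rmult_le_compat_r.
        { apply Rlt_le, exp_pos. }
        destruct (Rle_dec t 1) as [H1|H1].
        -- apply Rle_trans with 1; [|lra].
           assert (ln t <= 0) by (rewrite <- ln_1; apply ln_le; lra).
           unfold Rpower. replace 1 with (exp 0) at 2 by apply exp_0.
           apply exp_le_mono. nra.
        -- apply Rle_trans with (Rpower t 1); [|rewrite Rpower_1; lra].
           apply Rle_Rpower; lra.
    + rewrite (is_RInt_unique _ _ _ _ Hi).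
      assert (H1 : 0 <= (2 + b) * exp (- b)).
      { apply Rmult_le_pos; [lra|]. apply Rlt_le, exp_pos. }
      assert (H2 : (2 + a) * exp (- a) <= 2).
      { assert (Hq : 1 + a / 2 <= exp a).
        { pose proof (exp_ineq1_le a). lra. }
        rewrite exp_Ropp.
        apply Rmult_le_reg_r with (exp a); [apply exp_pos|].
        rewrite Rmult_assoc, Rinv_l by (apply Rgt_not_eq, exp_pos). lra. }
      lra.
Qed.

Lemma ex_gamma x :
  0 < x ->
  exists l, is_RInt_gen (gamma_density x) (at_right 0) (Rbar_locally p_infty) l.
Proof.
  assert (H : forall k x, 0 < x <= INR k + 2 ->
    exists l, is_RInt_gen (gamma_density x) (at_right 0) (Rbar_locally p_infty) l).
  { clear x. induction k as [|k IH]; intros x Hx.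
    - simpl in Hx. destruct (Rle_dec 1 x) as [H1|H1].
      + apply ex_gamma_1_2. lra.
      + destruct (ex_gamma_1_2 (x + 1)) as [l Hl]; [lra|].
        exists (l / x). apply is_RInt_gen_gamma_down; [lra|exact Hl].
    - rewrite S_INR in Hx. destruct (Rle_dec x (INR k + 2)) as [H1|H1].
      + apply IH. lra.
      + pose proof (pos_INR k). destruct (IH (x - 1)) as [l Hl]; [lra|].
        replace x with (x - 1 + 1) by ring.
        exists ((x - 1) * l). apply is_RInt_gen_gamma_up; [lra|exact Hl]. }
  intros Hx. destruct (INR_unbounded x) as [k Hk].
  apply (H k). lra.
Qed.

Lemma Gamma_int_eq x l :
  is_RInt_gen (gamma_density x) (at_right 0) (Rbar_locally p_infty) l ->
  Gamma_int x = l.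
Proof.
  intros Hl. exact (is_RInt_gen_unique (V := R_CompleteNormedModule) _ l Hl).
Qed.

Lemma Gamma_int_correct x :
  0 < x ->
  is_RInt_gen (gamma_density x) (at_right 0) (Rbar_locally p_infty) (Gamma_int x).
Proof.
  intros Hx. destruct (ex_gamma x Hx) as [l Hl].
  rewrite (Gamma_int_eq x l Hl). exact Hl.
Qed.

Lemma Gamma_int_rec x : 0 < x -> Gamma_int (x + 1) = x * Gamma_int x.
Proof.
  intros Hx. apply Gamma_int_eq, is_RInt_gen_gamma_up; [exact Hx|].
  apply Gamma_int_correct, Hx.
Qed.

Lemma Gamma_int_1 : Gamma_int 1 = 1.
Proof.
  apply Gamma_int_eq.
  apply is_RInt_gen_pos_ext with (fun t => exp (- t)).
  { intros t Ht. unfold gamma_density. rewrite Rminus_diag.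
    rewrite Rpower_O by exact Ht. ring. }
  replace 1 with (0 - - exp (- 0)) at 1 by (rewrite Ropp_0, exp_0; ring).
  apply is_RInt_gen_antiderivative with (fun t => - exp (- t)).
  - intros t Ht. auto_derive; [exact I|]. ring.
  - intros t Ht. apply derivable_continuous. auto_derive. exact I.
  - apply (continuous_at_right (fun t => - exp (- t))).
    apply derivable_continuous. auto_derive. exact I.
  - apply filterlim_ext_loc with (fun t => (-1) * gamma_density 1 t).
    { exists 0. intros t Ht. unfold gamma_density. rewrite Rminus_diag.
      rewrite Rpower_O by exact Ht. ring. }
    replace 0 with ((-1) * 0) at 1 by ring.
    apply (is_lim_scal_l (gamma_density 1) (-1) p_infty 0).
    apply filterlim_gamma_density_infty.
Qed.

(** The tangent-line bound [t ^ y >= 1 + y * (t - 1)] gives [Gamma (y + 1) >= 1] for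
    [y >= 1]; the recurrence carries positivity down to all positive arguments. *)
Lemma Gamma_int_pos x : 0 < x -> 0 < Gamma_int x.
Proof.
  intros Hx.
  assert (H1 : 1 <= Gamma_int (x + 1 + 1)).
  { set (y := x + 1).
    apply Rle_trans with (y * Gamma_int (1 + 1) - (y - 1) * Gamma_int 1).
    { rewrite Gamma_int_rec, Gamma_int_1 by lra. lra. }
    apply is_RInt_gen_pos_le with
      (fun t => y * gamma_density (1 + 1) t - (y - 1) * gamma_density 1 t)
      (gamma_density (y + 1)).
    - intros t Ht.
      rewrite !gamma_density_S by assumption.
      unfold gamma_density. rewrite Rminus_diag, Rpower_O by assumption.
      (* With [t ^ (y - 1) >= 1 + (y - 1) * ln t] and [ln t >= 1 - 1 / t], one gets
         [t ^ y >= t + (y - 1) * (t - 1)]. *)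
      assert (Hl : 1 - / t <= ln t).
      { pose proof (exp_ineq1_le (ln (/ t))) as H.
        rewrite exp_ln in H by (apply Rinv_0_lt_compat, Ht).
        rewrite ln_Rinv in H by exact Ht. lra. }
      assert (Hp : 1 + (y - 1) * ln t <= Rpower t (y - 1)) by apply exp_ineq1_le.
      assert (Hy : 0 < y - 1) by (unfold y; lra).
      assert (Hm : (y - 1) * (1 - / t) <= (y - 1) * ln t)
        by (apply Rmult_le_compat_l; lra).
      assert (Hq : t * (1 + (y - 1) * (1 - / t)) <= t * Rpower t (y - 1))
        by (apply Rmult_le_compat_l; lra).
      replace (t * (1 + (y - 1) * (1 - / t))) with (y * t - (y - 1)) in Hq
        by (field; lra).
      pose proof (exp_pos (- t)). nra.
    - apply (is_RInt_gen_minus (V := R_NormedModule));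
        apply (is_RInt_gen_scal (V := R_NormedModule)); apply Gamma_int_correct; lra.
    - apply Gamma_int_correct. unfold y; lra. }
  rewrite !Gamma_int_rec in H1 by lra.
  apply Rnot_le_lt. intros H.
  assert ((x + 1) * (x * Gamma_int x) <= 0); [|lra].
  assert (0 < (x + 1) * x) by nra. nra.
Qed.

(** * The Gamma integral at 1/2 *)

Lemma le_of_le_minus_inv (X Y : R) :
  0 <= Y -> (forall n : nat, Y - Y / INR (S n) <= X) -> Y <= X.
Proof.
  intros HY H. apply Rnot_lt_le. intros Hlt.
  destruct (INR_unbounded (Y / (Y - X))) as [n Hn].
  specialize (H n). rewrite S_INR in H. pose proof (pos_INR n) as Hp.
  assert (H1 : Y < (INR n + 1) * (Y - X)).
  { apply Rmult_lt_compat_r with (r := Y - X) in Hn; [|lra].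
    replace (Y / (Y - X) * (Y - X)) with Y in Hn by (field; lra). nra. }
  assert (H2 : Y / (INR n + 1) < Y - X).
  { apply Rmult_lt_reg_r with (INR n + 1); [lra|].
    replace (Y / (INR n + 1) * (INR n + 1)) with Y by (field; lra). lra. }
  lra.
Qed.

(** The recurrence makes the ratio of [u (2 n) / u (2 n + 1)] to
    [v (2 n) / v (2 n + 1)] independent of [n], and monotonicity squeezes both
    quotients between 1 and [(2 n + 2) / (2 n + 1)]. *)
Lemma wallis_ratio_le (u v : nat -> R) :
  (forall n, 0 < u n) -> (forall n, 0 < v n) ->
  (forall n, u (S n) <= u n) -> (forall n, v (S n) <= v n) ->
  (forall n, u (S (S n)) = INR (S n) / INR (S (S n)) * u n) ->
  (forall n, v (S (S n)) = INR (S n) / INR (S (S n)) * v n) ->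
  u 1%nat * v 0%nat <= u 0%nat * v 1%nat.
Proof.
  intros Hu Hv Du Dv Ru Rv.
  set (X := u 0%nat * v 1%nat). set (Y := u 1%nat * v 0%nat).
  assert (HY : 0 < Y) by (apply Rmult_lt_0_compat; auto).
  assert (E : forall n, u (2 * n)%nat * v (S (2 * n)) * Y = u (S (2 * n)) * v (2 * n)%nat * X).
  { induction n as [|n IH].
    - simpl. unfold X, Y. ring.
    - replace (2 * S n)%nat with (S (S (2 * n))) by lia.
      rewrite !Ru, !Rv.
      set (c := INR (S (2 * n)) / INR (S (S (2 * n)))).
      set (d := INR (S (S (2 * n))) / INR (S (S (S (2 * n))))).
      transitivity (c * d * (u (2 * n)%nat * v (S (2 * n)) * Y)); [ring|].
      rewrite IH. ring. }
  apply le_of_le_minus_inv; [lra|]. intros n.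
  set (A := u (S (2 * n)) * v (2 * n)%nat). specialize (E n). fold A in E.
  assert (HA : 0 < A) by (apply Rmult_lt_0_compat; auto).
  assert (Hb : A * (1 - / INR (S n)) <= u (2 * n)%nat * v (S (2 * n))).
  { unfold A. apply Rle_trans with (u (S (2 * n)) * v (S (S (2 * n)))).
    - rewrite Rv, Rmult_assoc. apply Rmult_le_compat_l; [apply Rlt_le, Hu|].
      rewrite Rmult_comm. apply Rmult_le_compat_r; [apply Rlt_le, Hv|].
      rewrite !S_INR, mult_INR. change (INR 2) with 2. pose proof (pos_INR n).
      apply Rminus_le_0.
      replace ((2 * INR n + 1) / (2 * INR n + 1 + 1) - (1 - / (INR n + 1)))
        with (/ (2 * (INR n + 1))) by (field; lra).
      apply Rlt_le, Rinv_0_lt_compat. lra.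
    - apply Rmult_le_compat; auto; apply Rlt_le; auto. }
  apply Rmult_le_reg_l with A; [exact HA|]. rewrite <- E.
  apply Rle_trans with (A * (1 - / INR (S n)) * Y).
  - right. unfold Rdiv. ring.
  - apply Rmult_le_compat_r; lra.
Qed.

Lemma wallis_ratio (u v : nat -> R) :
  (forall n, 0 < u n) -> (forall n, 0 < v n) ->
  (forall n, u (S n) <= u n) -> (forall n, v (S n) <= v n) ->
  (forall n, u (S (S n)) = INR (S n) / INR (S (S n)) * u n) ->
  (forall n, v (S (S n)) = INR (S n) / INR (S (S n)) * v n) ->
  u 1%nat * v 0%nat = u 0%nat * v 1%nat.
Proof.
  intros Hu Hv Du Dv Ru Rv. apply Rle_antisym.
  - apply wallis_ratio_le; assumption.
  - rewrite (Rmult_comm (u 0%nat)), (Rmult_comm (u 1%nat)).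
    apply wallis_ratio_le; assumption.
Qed.

Definition wallis_int (n : nat) : R := RInt (fun t => sin t ^ n) 0 (PI / 2).

Lemma ex_RInt_sin_pow n a b : ex_RInt (fun t => sin t ^ n) a b.
Proof.
  apply (ex_RInt_continuous (V := R_CompleteNormedModule)). intros z _.
  apply derivable_continuous. auto_derive. exact I.
Qed.

Lemma wallis_int_pos n : 0 < wallis_int n.
Proof.
  pose proof PI_RGT_0. apply RInt_gt_0; [lra| |].
  - intros x Hx. apply pow_lt, sin_gt_0; lra.
  - intros x _. apply derivable_continuous. auto_derive. exact I.
Qed.

Lemma wallis_int_decr n : wallis_int (S n) <= wallis_int n.
Proof.
  pose proof PI_RGT_0.
  apply RInt_le; try apply ex_RInt_sin_pow; [lra|].
  intros x Hx. simpl. pose proof (SIN_bound x).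
  assert (0 <= sin x ^ n) by (apply pow_le, sin_ge_0; lra). nra.
Qed.

Lemma wallis_int_rec n :
  wallis_int (S (S n)) = INR (S n) / INR (S (S n)) * wallis_int n.
Proof.
  assert (H : is_RInt (fun t => INR (S n) * sin t ^ n - INR (S (S n)) * sin t ^ (S (S n)))
                0 (PI / 2) (cos (PI / 2) * sin (PI / 2) ^ (S n) - cos 0 * sin 0 ^ (S n))).
  { apply (is_RInt_derive (fun t => cos t * sin t ^ (S n))).
    - intros t _. auto_derive; [exact I|]. rewrite (S_INR (S n)). simpl pred.
      pose proof (sin2_cos2 t) as Hsc. unfold Rsqr in Hsc.
      change (sin t ^ S (S n)) with (sin t * (sin t * sin t ^ n)).
      change (sin t ^ S n) with (sin t * sin t ^ n).
      change (match n with O => 1 | S _ => INR n + 1 end) with (INR (S n)).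
      transitivity (INR (S n) * sin t ^ n * (cos t * cos t) - sin t * (sin t * sin t ^ n));
        [ring|].
      replace (cos t * cos t) with (1 - sin t * sin t) by lra. ring.
    - intros t _. apply derivable_continuous. auto_derive. repeat split. }
  rewrite cos_PI2, sin_0, pow_i in H by lia.
  replace (0 * sin (PI / 2) ^ S n - cos 0 * 0) with 0 in H by ring.
  apply (is_RInt_unique (V := R_CompleteNormedModule)) in H.
  assert (E : RInt (fun t => INR (S n) * sin t ^ n - INR (S (S n)) * sin t ^ (S (S n))) 0 (PI / 2)
     = INR (S n) * wallis_int n - INR (S (S n)) * wallis_int (S (S n))).
  { apply is_RInt_unique.
    apply (is_RInt_minus (V := R_NormedModule));
      apply (is_RInt_scal (V := R_NormedModule));
      apply (RInt_correct (V := R_CompleteNormedModule)), ex_RInt_sin_pow. }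
  rewrite E in H.
  apply Rmult_eq_reg_l with (INR (S (S n))); [|apply not_0_INR; lia].
  transitivity (INR (S n) * wallis_int n); [lra|].
  field. apply not_0_INR; lia.
Qed.

(** Cauchy-Schwarz, obtained from the nonnegativity in [s] of the Euler integral of
    [(1 - s * sqrt t) ^ 2] and the choice of the optimal [s]. *)
Lemma Gamma_int_log_convex x :
  0 < x -> Gamma_int (x + 1 / 2) ^ 2 <= Gamma_int x * Gamma_int (x + 1).
Proof.
  intros Hx.
  set (A := Gamma_int x). set (B := Gamma_int (x + 1 / 2)). set (C := Gamma_int (x + 1)).
  assert (HC : 0 < C) by (apply Gamma_int_pos; lra).
  assert (H : forall s, 0 <= A + s ^ 2 * C - 2 * s * B).
  { intros s.
    cut (2 * s * B <= A + s ^ 2 * C); [lra|].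
    apply is_RInt_gen_pos_le with (fun t => 2 * s * gamma_density (x + 1 / 2) t)
      (fun t => gamma_density x t + s ^ 2 * gamma_density (x + 1) t).
    - intros t Ht. rewrite gamma_density_S by exact Ht. unfold gamma_density.
      replace (x + 1 / 2 - 1) with ((x - 1) + / 2) by field.
      rewrite Rpower_plus, Rpower_sqrt by exact Ht.
      assert (E : t = sqrt t * sqrt t) by (symmetry; apply sqrt_sqrt; lra).
      set (r := sqrt t) in *. rewrite E.
      assert (Hd : 0 < Rpower (r * r) (x - 1) * exp (- (r * r)))
        by apply (gamma_density_pos x).
      set (d := Rpower (r * r) (x - 1)) in *. set (e := exp (- (r * r))) in *.
      assert (0 <= (d * e) * (1 - s * r) ^ 2)
        by (apply Rmult_le_pos; [lra|apply pow2_ge_0]).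
      nra.
    - apply (is_RInt_gen_scal (V := R_NormedModule)), Gamma_int_correct. lra.
    - apply (is_RInt_gen_plus (V := R_NormedModule)).
      + apply Gamma_int_correct, Hx.
      + apply (is_RInt_gen_scal (V := R_NormedModule)), Gamma_int_correct. lra. }
  (* The minimum over [s] is attained at [B / C]. *)
  specialize (H (B / C)).
  replace (A + (B / C) ^ 2 * C - 2 * (B / C) * B) with ((A * C - B ^ 2) / C) in H
    by (field; lra).
  apply Rmult_le_compat_r with (r := C) in H; [|lra].
  replace ((A * C - B ^ 2) / C * C) with (A * C - B ^ 2) in H by (field; lra). lra.
Qed.

Definition wallis_gamma (n : nat) : R :=
  Gamma_int (INR n / 2 + 1 / 2) / Gamma_int (INR n / 2 + 1).

Lemma wallis_gamma_pos n : 0 < wallis_gamma n.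
Proof.
  pose proof (pos_INR n).
  apply Rdiv_lt_0_compat; apply Gamma_int_pos; lra.
Qed.

(** Log-convexity at half steps is exactly this monotonicity. *)
Lemma wallis_gamma_decr n : wallis_gamma (S n) <= wallis_gamma n.
Proof.
  unfold wallis_gamma. rewrite S_INR. pose proof (pos_INR n) as Hn.
  pose proof (Gamma_int_log_convex (INR n / 2 + 1 / 2) ltac:(lra)) as H.
  replace ((INR n + 1) / 2 + 1 / 2) with (INR n / 2 + 1) by field.
  replace ((INR n + 1) / 2 + 1) with (INR n / 2 + 1 / 2 + 1) by field.
  replace (INR n / 2 + 1 / 2 + 1 / 2) with (INR n / 2 + 1) in H by field.
  assert (0 < Gamma_int (INR n / 2 + 1)) by (apply Gamma_int_pos; lra).
  assert (0 < Gamma_int (INR n / 2 + 1 / 2 + 1)) by (apply Gamma_int_pos; lra).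
  apply Rminus_le_0.
  match goal with |- 0 <= ?a / ?b - ?b / ?c =>
    replace (a / b - b / c) with ((a * c - b ^ 2) / (b * c)) by (field; lra) end.
  apply Rdiv_le_0_compat; [lra|]. apply Rmult_lt_0_compat; assumption.
Qed.

Lemma wallis_gamma_rec n :
  wallis_gamma (S (S n)) = INR (S n) / INR (S (S n)) * wallis_gamma n.
Proof.
  unfold wallis_gamma. rewrite !S_INR. pose proof (pos_INR n) as Hn.
  replace ((INR n + 1 + 1) / 2 + 1 / 2) with (INR n / 2 + 1 / 2 + 1) by field.
  replace ((INR n + 1 + 1) / 2 + 1) with (INR n / 2 + 1 + 1) by field.
  rewrite !(Gamma_int_rec) by lra.
  assert (0 < Gamma_int (INR n / 2 + 1)) by (apply Gamma_int_pos; lra).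
  assert (0 < Gamma_int (INR n / 2 + 1 / 2)) by (apply Gamma_int_pos; lra).
  field. lra.
Qed.

(** The quotients [wallis_gamma] obey the same recurrence as the integrals of powers
    of the sine, so the two sequences are proportional; comparing the first two
    terms gives [Gamma (1 / 2) ^ 2 = PI]. *)
Lemma Gamma_int_half : Gamma_int (1 / 2) = sqrt PI.
Proof.
  pose proof (wallis_ratio wallis_gamma wallis_int wallis_gamma_pos wallis_int_pos
    wallis_gamma_decr wallis_int_decr wallis_gamma_rec wallis_int_rec) as H.
  assert (W0 : wallis_int 0 = PI / 2).
  { unfold wallis_int. simpl. rewrite RInt_const. unfold scal; simpl; unfold mult; simpl. ring. }
  assert (W1 : wallis_int 1 = 1).
  { apply is_RInt_unique.
    replace 1 with (minus (- cos (PI / 2)) (- cos 0))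
      by (rewrite cos_PI2, cos_0; unfold minus, plus, opp; simpl; ring).
    apply (is_RInt_derive (fun t => - cos t)).
    - intros t _. auto_derive; [exact I|]. ring.
    - intros t _. apply derivable_continuous. auto_derive. exact I. }
  rewrite W0, W1 in H. unfold wallis_gamma in H. simpl INR in H.
  replace (0 / 2 + 1 / 2) with (1 / 2) in H by field.
  replace (0 / 2 + 1) with 1 in H by field.
  replace (1 / 2 + 1 / 2) with 1 in H by field.
  rewrite Gamma_int_rec, Gamma_int_1 in H by lra.
  assert (Hp : 0 < Gamma_int (1 / 2)) by (apply Gamma_int_pos; lra).
  apply sym_eq, sqrt_lem_1; [pose proof PI_RGT_0; lra|lra|].
  assert (E : 1 / (1 / 2 * Gamma_int (1 / 2)) * (PI / 2) * Gamma_int (1 / 2) = PI)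
    by (field; lra).
  rewrite H in E. lra.
Qed.

(** * The reciprocal Gamma function *)

Lemma Gamma_shift_pos x : 0 < x -> Gamma_shift x = 0%nat.
Proof.
  intros Hx. unfold Gamma_shift.
  destruct (archimed (- x)) as [H1 H2].
  assert (H : (up (- x) < 1)%Z) by (apply lt_IZR; simpl; lra).
  destruct (up (- x)); try reflexivity. lia.
Qed.

Lemma Gamma_eq_int x : 0 < x -> Gamma x = Gamma_int x.
Proof.
  intros Hx. unfold Gamma. rewrite Gamma_shift_pos by exact Hx. simpl.
  rewrite Rplus_0_r. field.
Qed.

Lemma rGamma_eq_int x : 0 < x -> rGamma x = / Gamma_int x.
Proof.
  intros Hx. unfold rGamma. rewrite Gamma_shift_pos by exact Hx. simpl.
  rewrite Rplus_0_r. field. apply Rgt_not_eq, Gamma_int_pos, Hx.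
Qed.

Lemma rGamma_0 : rGamma 0 = 0.
Proof.
  unfold rGamma, Gamma_shift. rewrite Ropp_0.
  assert (E : up 0 = 1%Z).
  { symmetry. apply tech_up; simpl; lra. }
  rewrite E. simpl. unfold Rdiv. ring.
Qed.

(** At [x = 0] both sides vanish by the convention on [1 / Gamma]; for the Struve
    functions this case occurs at [nu = - 1 / 2]. *)
Lemma rGamma_rec x : 0 <= x -> rGamma x = x * rGamma (x + 1).
Proof.
  intros [Hx|<-].
  - rewrite !rGamma_eq_int, Gamma_int_rec by lra.
    field. split; apply Rgt_not_eq; [apply Gamma_int_pos|]; exact Hx.
  - rewrite rGamma_0. ring.
Qed.

Lemma rGamma_neq_0 x : 0 < x -> rGamma x <> 0.
Proof.
  intros Hx. rewrite rGamma_eq_int by exact Hx.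
  apply Rinv_neq_0_compat, Rgt_not_eq, Gamma_int_pos, Hx.
Qed.

(** * Finite sums and products *)

Lemma sum_telescope (f : nat -> R) (N : nat) :
  sum_f_R0 (fun x => f x - f (S x)) N = f 0%nat - f (S N).
Proof. induction N as [|N IH]; simpl; [ring|rewrite IH; ring]. Qed.

Lemma sum_exchange (f : nat -> nat -> R) (N M : nat) :
  sum_f_R0 (fun i => sum_f_R0 (f i) M) N = sum_f_R0 (fun j => sum_f_R0 (fun i => f i j) N) M.
Proof.
  induction N as [|N IH]; simpl; [reflexivity|].
  rewrite IH, <- sum_plus. apply sum_eq. intros; reflexivity.
Qed.

Lemma sum_scal (f : nat -> R) (c : R) (N : nat) :
  sum_f_R0 (fun i => c * f i) N = c * sum_f_R0 f N.
Proof. induction N as [|N IH]; simpl; [reflexivity|rewrite IH; ring]. Qed.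

Lemma sum_first (f : nat -> R) (N : nat) :
  sum_f_R0 f (S N) = f 0%nat + sum_f_R0 (fun i => f (S i)) N.
Proof. induction N as [|N IH]; [reflexivity|]. rewrite tech5, IH. simpl. ring. Qed.

Fixpoint prodn (f : nat -> R) (n : nat) : R :=
  match n with
  | O => 1
  | S k => prodn f k * f k
  end.

Lemma prodn_ext (f g : nat -> R) (n : nat) :
  (forall k, (k < n)%nat -> f k = g k) -> prodn f n = prodn g n.
Proof.
  induction n as [|n IH]; intros H; simpl; [reflexivity|].
  rewrite IH by (intros; apply H; lia). rewrite H by lia. reflexivity.
Qed.

Lemma prod_f_R0_prodn (f : nat -> R) (n : nat) : prod_f_R0 f n = prodn f (S n).
Proof. induction n as [|n IH]; simpl; [ring|rewrite IH; reflexivity]. Qed.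

Lemma nat_choice (A : Type) (P : nat -> A -> Prop) :
  (forall n, exists y, P n y) -> exists f : nat -> A, forall n, P n (f n).
Proof.
  intros H.
  exists (fun n => proj1_sig (constructive_indefinite_description _ (H n))).
  intros n. exact (proj2_sig (constructive_indefinite_description _ (H n))).
Qed.

(** * Polynomials with a full set of real roots *)

(** Polynomial functions of degree at most [d] in Horner form, so that synthetic
    division is a structural recursion on [d]. *)
Fixpoint polyfun (d : nat) (f : R -> R) : Prop :=
  match d with
  | O => exists c, forall s, f s = c
  | S e => exists c q, polyfun e q /\ forall s, f s = c + s * q s
  end.

Lemma polyfun_ext (d : nat) (f g : R -> R) :
  (forall s, g s = f s) -> polyfun d f -> polyfun d g.
Proof.
  intros E. destruct d as [|d]; simpl.
  - intros [c Hc]. exists c. intros s. rewrite E. apply Hc.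
  - intros (c & q & Hq & Hc). exists c, q. split; [exact Hq|]. intros s. rewrite E. apply Hc.
Qed.

Lemma polyfun_sum (c : nat -> R) (d : nat) :
  polyfun d (fun s => sum_f_R0 (fun m => c m * s ^ m) d).
Proof.
  revert c. induction d as [|d IH]; intros c.
  - exists (c 0%nat). intros s. simpl. ring.
  - exists (c 0%nat), (fun s => sum_f_R0 (fun m => c (S m) * s ^ m) d).
    split; [apply IH|]. intros s. rewrite sum_first, <- sum_scal. simpl pow.
    rewrite Rmult_1_r. f_equal. apply sum_eq. intros. simpl. ring.
Qed.

(** Synthetic division by [s - r], one Horner step at a time. *)
Lemma polyfun_factor (d : nat) (f : R -> R) (r : R) :
  polyfun (S d) f -> exists q, polyfun d q /\ forall s, f s - f r = (s - r) * q s.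
Proof.
  revert f. induction d as [|d IH]; intros f (c & g & Hg & Hf).
  - destruct Hg as [e He]. exists (fun _ => e). split; [exists e; reflexivity|].
    intros s. rewrite !Hf, !He. ring.
  - destruct (IH g Hg) as (q & Hq & E).
    exists (fun s => g r + s * q s). split; [exists (g r), q; auto|].
    intros s. rewrite !Hf. replace (g s) with (g r + (s - r) * q s) by (rewrite <- E; ring).
    ring.
Qed.

Lemma polyfun_roots (d : nat) (f : R -> R) (r : nat -> R) :
  polyfun d f ->
  (forall j, (j < d)%nat -> r j <> 0 /\ f (r j) = 0) ->
  (forall i j, (i < j < d)%nat -> r i <> r j) ->
  forall s, f s = f 0 * prodn (fun j => 1 - s / r j) d.
Proof.
  revert f. induction d as [|d IH]; intros f Hf Hr Hd s.
  - destruct Hf as [c Hc]. simpl. rewrite !Hc. ring.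
  - destruct (polyfun_factor d f (r d) Hf) as (q & Hq & E).
    destruct (Hr d ltac:(lia)) as [H0 Hz]. rewrite Hz in E.
    assert (Es : forall s, f s = (s - r d) * q s) by (intros; rewrite <- E; ring).
    rewrite !Es. rewrite (IH q Hq).
    + simpl. field. exact H0.
    + intros j Hj. destruct (Hr j ltac:(lia)) as [Hj0 Hjz]. split; [exact Hj0|].
      rewrite Es in Hjz. apply Rmult_integral in Hjz as [Hjz|Hjz]; [|exact Hjz].
      exfalso. apply (Hd j d ltac:(lia)). lra.
    + intros i j Hij. apply Hd. lia.
Qed.

(** * The approximating sine polynomials *)

(** The factors are [x (x + 1) - k (k + 1)], so these polynomials are invariant under
    [x -> - 1 - x], like the quotient of [sin ((2 x + 1) th)] by [2 x + 1]; up to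
    constants they are its coefficients in powers of [sin th]. *)
Fixpoint central_factorial (m : nat) (x : R) : R :=
  match m with
  | O => 1
  | S k => central_factorial k x * ((x - INR k) * (x + 1 + INR k))
  end.

Lemma central_factorial_shift (m : nat) (x : R) :
  central_factorial m (x + 1) * (x + 1 - INR m) = central_factorial m x * (x + 1 + INR m).
Proof.
  induction m as [|m IH]; [simpl; ring|].
  rewrite S_INR. simpl central_factorial.
  transitivity (central_factorial m (x + 1) * (x + 1 - INR m)
                * ((x + 2 + INR m) * (x - INR m))); [ring|].
  rewrite IH. ring.
Qed.

Lemma central_factorial_up (m : nat) (x : R) :
  central_factorial (S m) (x + 1)
  = central_factorial m x * ((x + 1 + INR m) * (x + 2 + INR m)).
Proof.
  simpl. transitivity (central_factorial m (x + 1) * (x + 1 - INR m) * (x + 2 + INR m)); [ring|].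
  rewrite central_factorial_shift. ring.
Qed.

Lemma central_factorial_down (m : nat) (x : R) :
  central_factorial (S m) (x - 1)
  = central_factorial m x * ((x - INR m) * (x - 1 - INR m)).
Proof.
  pose proof (central_factorial_shift m (x - 1)) as H.
  replace (x - 1 + 1) with x in H by ring.
  simpl. transitivity (central_factorial m (x - 1) * (x + INR m) * (x - 1 - INR m)); [ring|].
  rewrite <- H. ring.
Qed.

Lemma central_factorial_nat (m x : nat) : (x < m)%nat -> central_factorial m (INR x) = 0.
Proof.
  induction m as [|m IH]; intros H; [lia|]. simpl.
  destruct (Nat.eq_dec x m) as [->|Hn]; [ring|]. rewrite IH by lia. ring.
Qed.

Lemma central_factorial_m1 (m : nat) : (0 < m)%nat -> central_factorial m (- 1) = 0.
Proof.
  induction m as [|m IH]; intros H; [lia|]. simpl.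
  destruct m as [|m]; [simpl; ring|]. rewrite IH by lia. ring.
Qed.

(** The expansion of [sin ((2 x + 1) th) / sin th] in powers of [s = sin th ^ 2]. A
    real [x] is allowed so that the three-term recurrence can start from
    [x = - 1]. *)
Definition odd_sine (N : nat) (x s : R) : R :=
  sum_f_R0 (fun m => (- 4 * s) ^ m / INR (fact (2 * m + 1))
                     * ((2 * x + 1) * central_factorial m x)) N.

Lemma fact_odd_S (m : nat) :
  INR (fact (2 * S m + 1))
  = (2 * INR m + 3) * (2 * INR m + 2) * INR (fact (2 * m + 1)).
Proof.
  replace (2 * S m + 1)%nat with (S (S (2 * m + 1))) by lia.
  rewrite !fact_simpl, !mult_INR, !S_INR, plus_INR, mult_INR. simpl (INR 1).
  change (INR 2) with 2. ring.
Qed.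

(** The Chebyshev recurrence with [2 * cos (2 * th) = 2 - 4 * s], checked
    coefficient by coefficient; the hypothesis says that the expansion at [x] stops
    before its last term. *)
Lemma odd_sine_rec (N : nat) (x s : R) :
  central_factorial (S N) x = 0 ->
  odd_sine (S N) (x + 1) s = (2 - 4 * s) * odd_sine (S N) x s - odd_sine (S N) (x - 1) s.
Proof.
  intros H0.
  assert (E : odd_sine (S N) (x + 1) s + odd_sine (S N) (x - 1) s
              - 2 * odd_sine (S N) x s = - 4 * s * odd_sine N x s).
  { unfold odd_sine. rewrite !sum_first, <- !sum_scal. simpl (central_factorial 0 _).
    transitivity (sum_f_R0 (fun i =>
        (- 4 * s) ^ S i / INR (fact (2 * S i + 1)) *
          ((2 * (x + 1) + 1) * central_factorial (S i) (x + 1)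
           + (2 * (x - 1) + 1) * central_factorial (S i) (x - 1)
           - 2 * ((2 * x + 1) * central_factorial (S i) x))) N).
    - transitivity (sum_f_R0 (fun i =>
         (- 4 * s) ^ S i / INR (fact (2 * S i + 1)) *
           ((2 * (x + 1) + 1) * central_factorial (S i) (x + 1))
         + (- 4 * s) ^ S i / INR (fact (2 * S i + 1)) *
           ((2 * (x - 1) + 1) * central_factorial (S i) (x - 1))
         - 2 * ((- 4 * s) ^ S i / INR (fact (2 * S i + 1)) *
           ((2 * x + 1) * central_factorial (S i) x))) N).
      + rewrite minus_sum, sum_plus, sum_scal. field. apply INR_fact_neq_0.
      + apply sum_eq. intros i _. field. apply INR_fact_neq_0.
    - apply sum_eq. intros i _.
      rewrite central_factorial_up, central_factorial_down, fact_odd_S.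
      simpl central_factorial. pose proof (pos_INR i). simpl pow.
      pose proof (INR_fact_neq_0 (2 * i + 1)). field. repeat split; try assumption; lra. }
  assert (E2 : odd_sine (S N) x s = odd_sine N x s).
  { unfold odd_sine. rewrite tech5, H0. ring. }
  rewrite E2 in *. lra.
Qed.

Lemma odd_sine_correct (N x : nat) (th : R) :
  (x <= N)%nat ->
  sin ((2 * INR x + 1) * th) = sin th * odd_sine N (INR x) (sin th ^ 2).
Proof.
  intros Hx.
  assert (H : sin ((2 * (INR x - 1) + 1) * th) = sin th * odd_sine N (INR x - 1) (sin th ^ 2)
    /\ sin ((2 * INR x + 1) * th) = sin th * odd_sine N (INR x) (sin th ^ 2)).
  { induction x as [|x IH].
    - simpl (INR 0). clear. split.
      + replace ((2 * (0 - 1) + 1) * th) with (- th) by ring. rewrite sin_neg.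
        assert (E : odd_sine N (0 - 1) (sin th ^ 2) = - 1); [|rewrite E; ring].
        unfold odd_sine. induction N as [|N IH]; [simpl; field|].
        rewrite tech5, IH. replace (0 - 1) with (-1) by ring.
        rewrite central_factorial_m1 by lia. ring.
      + replace ((2 * 0 + 1) * th) with th by ring.
        assert (E : odd_sine N 0 (sin th ^ 2) = 1); [|rewrite E; ring].
        unfold odd_sine. induction N as [|N IH]; [simpl; field|].
        pose proof (central_factorial_nat (S N) 0 ltac:(lia)) as H. change (INR 0) with 0 in H.
        rewrite tech5, IH, H. ring.
    - destruct (IH ltac:(lia)) as [H1 H2].
      rewrite S_INR. replace (INR x + 1 - 1) with (INR x) by ring. split; [exact H2|].
      destruct N as [|N]; [lia|].
      rewrite odd_sine_rec by (apply central_factorial_nat; lia).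
      assert (E : sin ((2 * (INR x + 1) + 1) * th)
                  = 2 * cos (2 * th) * sin ((2 * INR x + 1) * th)
                    - sin ((2 * (INR x - 1) + 1) * th)).
      { replace ((2 * (INR x + 1) + 1) * th) with ((2 * INR x + 1) * th + 2 * th) by ring.
        replace ((2 * (INR x - 1) + 1) * th) with ((2 * INR x + 1) * th - 2 * th) by ring.
        rewrite sin_plus, sin_minus. ring. }
      rewrite E, H1, H2, cos_2a_sin. ring. }
  exact (proj2 H).
Qed.

(** * Increasing weights with explicit moments *)

(** The sum of [(2 y + 1) * weight lam N y] over [x <= y <= N], which has a closed
    form; its value at [x = 0] is normalized to 1. *)
Fixpoint weight_tail (lam : R) (N x : nat) : R :=
  match x with
  | O => 1
  | S y => weight_tail lam N y
           * ((INR N - INR y) * (INR N + 1 + INR y + lam)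
              / ((INR N - INR y + lam) * (INR N + 1 + INR y)))
  end.

(** Proportional to [alpha (N - x) * alpha (N + 1 + x)] with
    [alpha j = lam (lam + 1) ... (lam + j - 1) / j!]. For [x = t N] and large [N] this
    behaves like [(1 - t ^ 2) ^ (lam - 1)]. *)
Definition weight (lam : R) (N x : nat) : R :=
  weight_tail lam N x * lam / ((INR N - INR x + lam) * (INR N + 1 + INR x)).

Lemma weight_tail_pos (lam : R) (N x : nat) :
  0 < lam -> (x <= N)%nat -> 0 < weight_tail lam N x.
Proof.
  intros Hl. induction x as [|x IH]; intros Hx; simpl; [lra|].
  assert (INR x < INR N) by (apply lt_INR; lia). pose proof (pos_INR x).
  apply Rmult_lt_0_compat; [apply IH; lia|].
  apply Rdiv_lt_0_compat; apply Rmult_lt_0_compat; lra.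
Qed.

Lemma weight_pos (lam : R) (N x : nat) :
  0 < lam -> (x <= N)%nat -> 0 < weight lam N x.
Proof.
  intros Hl Hx. pose proof (weight_tail_pos lam N x Hl Hx).
  apply le_INR in Hx. pose proof (pos_INR x).
  apply Rdiv_lt_0_compat; apply Rmult_lt_0_compat; lra.
Qed.

Lemma weight_tail_diff (lam : R) (N x : nat) :
  0 < lam -> (x <= N)%nat ->
  (2 * INR x + 1) * weight lam N x = weight_tail lam N x - weight_tail lam N (S x).
Proof.
  intros Hl Hx. apply le_INR in Hx. pose proof (pos_INR x). unfold weight. simpl.
  field. lra.
Qed.

Lemma weight_tail_end (lam : R) (N : nat) : weight_tail lam N (S N) = 0.
Proof. simpl. unfold Rdiv. ring. Qed.

(** At [lam = 1] all weights coincide; there the roots become double in the limit. *)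
Lemma weight_incr (lam : R) (N x : nat) :
  0 < lam < 1 -> (x < N)%nat -> weight lam N x < weight lam N (S x).
Proof.
  intros Hl Hx. pose proof (weight_tail_pos lam N x (proj1 Hl) ltac:(lia)) as Ht.
  apply le_INR in Hx. rewrite S_INR in Hx. pose proof (pos_INR x).
  apply Rminus_lt_0. unfold weight. simpl weight_tail. rewrite S_INR.
  set (n := INR N) in *. set (y := INR x) in *. set (t := weight_tail lam N x) in *.
  replace (t * ((n - y) * (n + 1 + y + lam) / ((n - y + lam) * (n + 1 + y))) * lam
      / ((n - (y + 1) + lam) * (n + 1 + (y + 1)))
      - t * lam / ((n - y + lam) * (n + 1 + y)))
    with (t * lam * ((1 - lam) * (2 * y + 2))
      / ((n - y + lam) * (n + 1 + y) * ((n - (y + 1) + lam) * (n + 2 + y))))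
    by (field; lra).
  apply Rdiv_lt_0_compat; repeat apply Rmult_lt_0_compat; lra.
Qed.

Definition moment (lam : R) (N m : nat) : R :=
  sum_f_R0 (fun x => (2 * INR x + 1) * weight lam N x * central_factorial m (INR x)) N.

Lemma moment_0 (lam : R) (N : nat) : 0 < lam -> moment lam N 0 = 1.
Proof.
  intros Hl. unfold moment.
  transitivity (weight_tail lam N 0 - weight_tail lam N (S N));
    [|rewrite weight_tail_end; simpl; ring].
  rewrite <- sum_telescope.
  apply sum_eq. intros x Hx. rewrite <- weight_tail_diff by assumption. simpl. ring.
Qed.

(** A discrete integration by parts. The difference of the two summands is [lam]
    times the decrement, from [x] to [x + 1], of the product of [weight_tail] with [x * (x - m) * central_factorial m x], which
    vanishes at [x = 0] and at [x = N + 1]. *)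
Lemma moment_S (lam : R) (N m : nat) :
  0 < lam ->
  (lam + INR m + 1) * moment lam N (S m)
  = (INR m + 1) * (INR N - INR m) * (INR N + lam + INR m + 1) * moment lam N m.
Proof.
  intros Hl. unfold moment. rewrite <- !sum_scal. apply Rminus_diag_uniq.
  rewrite <- minus_sum.
  (* The discrete antiderivative. *)
  set (T := fun x => weight_tail lam N x
                     * (INR x * (INR x - INR m) * central_factorial m (INR x))).
  transitivity (lam * sum_f_R0 (fun x => T x - T (S x)) N).
  - rewrite <- sum_scal. apply sum_eq. intros x Hx. unfold T.
    rewrite S_INR.
    replace ((INR x + 1) * (INR x + 1 - INR m) * central_factorial m (INR x + 1))
      with ((INR x + 1) * (central_factorial m (INR x + 1) * (INR x + 1 - INR m))) by ring.
    rewrite central_factorial_shift. unfold weight. simpl.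
    apply le_INR in Hx. pose proof (pos_INR x). field. lra.
  - rewrite sum_telescope. unfold T. rewrite weight_tail_end. simpl. ring.
Qed.

(** * Real roots of the approximating polynomials *)

Definition approx (lam : R) (N : nat) (s : R) : R :=
  sum_f_R0 (fun m => (- 4 * s) ^ m / INR (fact (2 * m + 1)) * moment lam N m) N.

(** Expanding each sine in powers of [sin th] and exchanging the summations produces
    the moments. *)
Lemma approx_sine_sum (lam : R) (N : nat) (th : R) :
  sin th * approx lam N (sin th ^ 2)
  = sum_f_R0 (fun x => weight lam N x * sin ((2 * INR x + 1) * th)) N.
Proof.
  unfold approx, moment. rewrite <- sum_scal.
  transitivity (sum_f_R0 (fun m => sum_f_R0 (fun x =>
     weight lam N x * (sin th * ((- 4 * sin th ^ 2) ^ m / INR (fact (2 * m + 1))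
       * ((2 * INR x + 1) * central_factorial m (INR x))))) N) N).
  - apply sum_eq. intros m _. rewrite <- !sum_scal. apply sum_eq. intros x _. ring.
  - rewrite sum_exchange. apply sum_eq. intros x Hx.
    rewrite (odd_sine_correct N) by exact Hx. unfold odd_sine.
    rewrite <- !sum_scal. reflexivity.
Qed.

Lemma Rabs_sin_nat (n : nat) (th : R) : Rabs (sin (INR n * th)) <= INR n * Rabs (sin th).
Proof.
  induction n as [|n IH].
  - simpl. rewrite !Rmult_0_l, sin_0, Rabs_R0. lra.
  - rewrite S_INR. replace ((INR n + 1) * th) with (INR n * th + th) by ring.
    rewrite sin_plus.
    apply Rle_trans with (1 := Rabs_triang _ _). rewrite !Rabs_mult.
    assert (H : forall y, Rabs (cos y) <= 1).
    { intros y. apply Rabs_le. apply COS_bound. }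
    pose proof (H th). pose proof (H (INR n * th)).
    pose proof (Rabs_pos (sin th)). pose proof (Rabs_pos (sin (INR n * th))).
    pose proof (Rabs_pos (cos th)). pose proof (Rabs_pos (cos (INR n * th))). nra.
Qed.

(** With total mass [moment lam N 0 = 1], the value is an average of the quotients
    [sin (k th) / (k sin th)]. *)
Lemma approx_bound (lam : R) (N : nat) (th : R) :
  0 < lam -> sin th <> 0 -> Rabs (approx lam N (sin th ^ 2)) <= 1.
Proof.
  intros Hl Hs. apply Rabs_pos_lt in Hs.
  apply Rmult_le_reg_l with (Rabs (sin th)); [exact Hs|].
  rewrite <- Rabs_mult, approx_sine_sum, Rmult_1_r.
  apply Rle_trans with (sum_f_R0 (fun x => Rabs (weight lam N x * sin ((2 * INR x + 1) * th))) N).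
  { apply Rsum_abs. }
  apply Rle_trans with (Rabs (sin th) * moment lam N 0); [|rewrite moment_0 by exact Hl; lra].
  unfold moment. rewrite <- sum_scal. apply sum_Rle. intros x Hx.
  pose proof (weight_pos lam N x Hl Hx). rewrite Rabs_mult, (Rabs_pos_eq (weight _ _ _)) by lra.
  pose proof (Rabs_sin_nat (2 * x + 1) th) as H1.
  rewrite plus_INR, mult_INR in H1. change (INR 2) with 2 in H1. simpl (INR 1) in H1.
  simpl. apply Rle_trans with (weight lam N x * ((2 * INR x + 1) * Rabs (sin th)));
    [apply Rmult_le_compat_l; lra|right; ring].
Qed.

(** Abel summation writes the sum as [a 0] plus the increments of [a] times cosines,
    minus [a N * c (N + 1)]; replacing the cosines by -1 gives the bound. *)
Lemma abel_lower (a c : nat -> R) (N : nat) :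
  c 0%nat = 1 -> (forall x, -1 <= c x) ->
  (forall x, (x < N)%nat -> a x <= a (S x)) ->
  2 * a 0%nat - a N * (1 + c (S N)) <= sum_f_R0 (fun x => a x * (c x - c (S x))) N.
Proof.
  intros H0 Hc. induction N as [|N IH]; intros Ha.
  - simpl. rewrite H0. lra.
  - rewrite tech5. specialize (IH ltac:(intros; apply Ha; lia)).
    pose proof (Ha N ltac:(lia)). pose proof (Hc (S N)). nra.
Qed.

(** The same summation with the cosines replaced by 1, except the first of them,
    which is kept to make the inequality strict later on. *)
Lemma abel_upper (a c : nat -> R) (N : nat) :
  c 0%nat = 1 -> (forall x, c x <= 1) ->
  (forall x, (x < S N)%nat -> a x <= a (S x)) ->
  sum_f_R0 (fun x => a x * (c x - c (S x))) (S N)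
  <= a (S N) * (1 - c (S (S N))) - (a 1%nat - a 0%nat) * (1 - c 1%nat).
Proof.
  intros H0 Hc. induction N as [|N IH]; intros Ha.
  - simpl. rewrite H0. lra.
  - rewrite tech5. specialize (IH ltac:(intros; apply Ha; lia)).
    pose proof (Ha (S N) ltac:(lia)). pose proof (Hc (S (S N))). nra.
Qed.

Lemma cos_nat_PI (m : nat) : cos (INR m * PI) = (-1) ^ m.
Proof.
  induction m as [|m IH].
  - simpl. rewrite Rmult_0_l. apply cos_0.
  - rewrite S_INR. replace ((INR m + 1) * PI) with (INR m * PI + PI) by ring.
    rewrite neg_cos, IH. simpl. ring.
Qed.

Definition node (N m : nat) : R := INR m * PI / (2 * (INR N + 1)).

Lemma node_bounds (N m : nat) :
  (1 <= m <= S N)%nat -> 0 < node N m <= PI / 2.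
Proof.
  intros [H1 H2]. apply le_INR in H1, H2. rewrite S_INR in H2. simpl in H1.
  pose proof PI_RGT_0. pose proof (pos_INR N). unfold node. split.
  - apply Rdiv_lt_0_compat; [apply Rmult_lt_0_compat|]; lra.
  - apply Rmult_le_reg_r with (2 * (INR N + 1)); [lra|].
    replace (INR m * PI / (2 * (INR N + 1)) * (2 * (INR N + 1))) with (INR m * PI) by (field; lra).
    replace (PI / 2 * (2 * (INR N + 1))) with ((INR N + 1) * PI) by field.
    apply Rmult_le_compat_r; lra.
Qed.

(** After multiplication by [2 * sin th] the sine sum becomes a sum of increasing
    weights against differences of cosines. At the nodes the last cosine,
    [cos (2 * (N + 1) * th)], is 1 or -1 and decides the sign. *)
Lemma approx_sign (lam : R) (N m : nat) :
  0 < lam < 1 -> (1 <= N)%nat -> (1 <= m <= S N)%nat ->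
  (-1) ^ m * approx lam N (sin (node N m) ^ 2) < 0.
Proof.
  intros Hl HN Hm.
  destruct (node_bounds N m Hm) as [Hn0 Hn1]. pose proof PI_RGT_0 as HPI.
  set (th := node N m) in *.
  assert (Hs : 0 < sin th) by (apply sin_gt_0; lra).
  set (c := fun x => cos (INR x * (2 * th))).
  assert (E : 2 * sin th * (sin th * approx lam N (sin th ^ 2))
              = sum_f_R0 (fun x => weight lam N x * (c x - c (S x))) N).
  { rewrite approx_sine_sum, <- sum_scal. apply sum_eq. intros x _.
    unfold c. rewrite S_INR.
    replace (INR x * (2 * th)) with ((2 * INR x + 1) * th - th) by ring.
    replace ((INR x + 1) * (2 * th)) with ((2 * INR x + 1) * th + th) by ring.
    rewrite cos_plus, cos_minus. ring. }
  assert (c0 : c 0%nat = 1) by (unfold c; simpl; rewrite Rmult_0_l; apply cos_0).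
  assert (cb : forall x, -1 <= c x <= 1) by (intros; apply COS_bound).
  assert (cN : c (S N) = (-1) ^ m).
  { unfold c, th, node. rewrite <- cos_nat_PI. f_equal. rewrite S_INR.
    pose proof (pos_INR N). field. lra. }
  assert (Hinc : forall x, (x < N)%nat -> weight lam N x <= weight lam N (S x))
    by (intros; apply Rlt_le, weight_incr; assumption).
  assert (K : (-1) ^ m * sum_f_R0 (fun x => weight lam N x * (c x - c (S x))) N < 0).
  { destruct (Nat.Even_or_Odd m) as [[k Hk]|[k Hk]].
    - assert (Em : (-1) ^ m = 1) by (rewrite Hk; apply pow_1_even).
      rewrite Em in *. destruct N as [|N]; [lia|].
      pose proof (abel_upper _ c N c0 (fun x => proj2 (cb x)) Hinc) as H.
      rewrite cN in H. pose proof (weight_incr lam (S N) 0 Hl ltac:(lia)) as H1.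
      assert (c 1%nat < 1).
      { unfold c. simpl. rewrite Rmult_1_l, cos_2a_sin. nra. }
      nra.
    - assert (Em : (-1) ^ m = -1).
      { rewrite Hk, Nat.add_1_r. apply pow_1_odd. }
      rewrite Em in *.
      pose proof (abel_lower _ c N c0 (fun x => proj1 (cb x)) Hinc) as H.
      rewrite cN in H. pose proof (weight_pos lam N 0 (proj1 Hl) ltac:(lia)). lra. }
  rewrite <- E in K.
  apply Rmult_lt_reg_l with (2 * sin th * sin th); [nra|]. lra.
Qed.

Lemma continuity_approx (lam : R) (N : nat) : continuity (fun th => approx lam N (sin th ^ 2)).
Proof.
  unfold approx. generalize N at 2 as M. induction M as [|M IH].
  - simpl. intros th. apply continuity_pt_const. intros x y. reflexivity.
  - simpl sum_f_R0. apply continuity_plus; [exact IH|].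
    intros th. apply derivable_continuous_pt. apply ex_derive_Reals_0.
    auto_derive. exact I.
Qed.

Lemma node_lt (N m k : nat) : (m < k)%nat -> node N m < node N k.
Proof.
  intros H. apply lt_INR in H. pose proof PI_RGT_0. pose proof (pos_INR N). unfold node.
  apply Rmult_lt_compat_r; [apply Rinv_0_lt_compat; lra|]. apply Rmult_lt_compat_r; lra.
Qed.

Lemma node_le (N m k : nat) : (m <= k)%nat -> node N m <= node N k.
Proof.
  intros H. destruct (Nat.eq_dec m k) as [->|Hn]; [lra|]. apply Rlt_le, node_lt. lia.
Qed.

Lemma approx_root (lam : R) (N j : nat) :
  0 < lam < 1 -> (j < N)%nat ->
  exists ph, node N (j + 1) < ph < node N (j + 2) /\ approx lam N (sin ph ^ 2) = 0.
Proof.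
  intros Hl Hj.
  pose proof (approx_sign lam N (j + 1) Hl ltac:(lia) ltac:(lia)) as H1.
  pose proof (approx_sign lam N (j + 2) Hl ltac:(lia) ltac:(lia)) as H2.
  set (f := fun th => approx lam N (sin th ^ 2)).
  change (approx lam N (sin (node N (j + 1)) ^ 2)) with (f (node N (j + 1))) in H1.
  change (approx lam N (sin (node N (j + 2)) ^ 2)) with (f (node N (j + 2))) in H2.
  replace ((-1) ^ (j + 2)) with (- (-1) ^ (j + 1)) in H2
    by (replace (j + 2)%nat with (S (j + 1)) by lia; simpl; ring).
  assert (Hsq : (-1) ^ (j + 1) * (-1) ^ (j + 1) = 1).
  { rewrite <- pow_add. replace (j + 1 + (j + 1))%nat with (2 * (j + 1))%nat by lia.
    rewrite pow_mult. replace ((-1) ^ 2) with 1 by ring. apply pow1. }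
  destruct (IVT_cor f (node N (j + 1)) (node N (j + 2)) (continuity_approx lam N))
    as (ph & Hph & Hz).
  - apply node_le. lia.
  - nra.
  - exists ph. split; [|exact Hz]. split.
    + destruct (proj1 Hph) as [H|E]; [exact H|]. rewrite E, Hz in H1. lra.
    + destruct (proj2 Hph) as [H|E]; [exact H|]. rewrite <- E, Hz in H2. lra.
Qed.

(** The sign alternates at [N + 1] nodes, which gives as many roots as the degree;
    the value at 0 is 1. *)
Lemma approx_factorization (lam : R) (N : nat) :
  0 < lam < 1 ->
  exists ph : nat -> R,
    (forall j, (j < N)%nat -> node N (j + 1) < ph j < node N (j + 2)) /\
    forall s, approx lam N s = prodn (fun j => 1 - s / sin (ph j) ^ 2) N.
Proof.
  intros Hl.
  destruct (nat_choice R (fun j ph => (j < N)%nat ->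
     node N (j + 1) < ph < node N (j + 2) /\ approx lam N (sin ph ^ 2) = 0)) as [ph Hph].
  { intros j. destruct (le_lt_dec N j) as [H|H]; [exists 0; lia|].
    destruct (approx_root lam N j Hl H) as [ph Hph]. exists ph. auto. }
  exists ph. split; [intros j Hj; apply Hph, Hj|].
  assert (Hb : forall j, (j < N)%nat -> 0 < ph j < PI / 2).
  { intros j Hj. destruct (Hph j Hj) as [H _].
    pose proof (node_bounds N (j + 1) ltac:(lia)).
    pose proof (node_bounds N (j + 2) ltac:(lia)). lra. }
  pose proof PI_RGT_0 as HPI.
  assert (Hs : forall j, (j < N)%nat -> 0 < sin (ph j))
    by (intros j Hj; apply sin_gt_0; specialize (Hb j Hj); lra).
  intros s.
  rewrite (polyfun_roots N (approx lam N) (fun j => sin (ph j) ^ 2)).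
  - replace (approx lam N 0) with 1; [ring|].
    unfold approx. destruct N as [|N].
    + simpl. rewrite moment_0 by lra. field.
    + rewrite sum_first. rewrite (sum_eq _ (fun _ => 0)), sum_cte.
      * simpl. rewrite moment_0 by lra. field.
      * intros i _. rewrite Rmult_0_r, pow_i by lia. unfold Rdiv. ring.
  - apply (polyfun_ext N) with (2 := polyfun_sum
      (fun m => (-4) ^ m / INR (fact (2 * m + 1)) * moment lam N m) N).
    intros t. apply sum_eq. intros m _. rewrite Rpow_mult_distr. field. apply INR_fact_neq_0.
  - intros j Hj. split; [|apply Hph, Hj].
    apply pow_nonzero. specialize (Hs j Hj). lra.
  - intros i j Hij. apply Rlt_not_eq.
    assert (Hlt : ph i < ph j).
    { apply Rlt_le_trans with (node N (i + 2)); [apply (Hph i ltac:(lia))|].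
      apply Rle_trans with (node N (j + 1)); [apply node_le; lia|].
      apply Rlt_le, (Hph j ltac:(lia)). }
    pose proof (Hb i ltac:(lia)). pose proof (Hb j ltac:(lia)).
    assert (sin (ph i) < sin (ph j)) by (apply sin_increasing_1; lra).
    pose proof (Hs i ltac:(lia)). simpl. nra.
Qed.

(** * Dominated convergence for series and products *)

Lemma ex_series_le_Rabs (a b : nat -> R) :
  (forall m, Rabs (a m) <= b m) -> ex_series b -> ex_series a.
Proof. intros H Hb. apply (ex_series_le (V := R_CompleteNormedModule) a b); assumption. Qed.

Lemma Series_Rabs_le (a b : nat -> R) :
  (forall m, Rabs (a m) <= b m) -> ex_series b -> Rabs (Series a) <= Series b.
Proof.
  intros H Hb.
  assert (Ha : ex_series (fun m => Rabs (a m))).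
  { apply ex_series_le_Rabs with b; [|exact Hb]. intros m. rewrite Rabs_Rabsolu. apply H. }
  apply Rle_trans with (Series (fun m => Rabs (a m))).
  - apply Series_Rabs, Ha.
  - apply Series_le; [|exact Hb]. intros m. split; [apply Rabs_pos|apply H].
Qed.

Lemma series_tail_small (b : nat -> R) (eps : R) :
  ex_series b -> 0 < eps -> exists M, Rabs (Series (fun k => b (S M + k)%nat)) < eps.
Proof.
  intros [l Hl] He.
  assert (H : is_lim_seq (sum_n b) l) by exact Hl.
  apply is_lim_seq_spec in H. destruct (H (mkposreal eps He)) as [M HM].
  exists M. specialize (HM M (le_n _)). simpl in HM.
  rewrite sum_n_Reals in HM.
  rewrite <- (is_series_unique _ _ Hl) in HM.
  assert (E : Series b = sum_f_R0 b M + Series (fun k => b (S M + k)%nat)).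
  { apply (Series_incr_n b (S M)); [lia|]. exists l. exact Hl. }
  rewrite E in HM. apply Rabs_lt_between in HM. apply Rabs_lt_between. lra.
Qed.

Lemma is_lim_seq_sum_f_R0 (t : nat -> nat -> R) (T : nat -> R) (M : nat) :
  (forall m, is_lim_seq (fun n => t n m) (T m)) ->
  is_lim_seq (fun n => sum_f_R0 (t n) M) (sum_f_R0 T M).
Proof.
  intros H. induction M as [|M IH]; simpl; [apply H|].
  apply is_lim_seq_plus'; [exact IH|apply H].
Qed.

Lemma is_lim_seq_Rabs_le (u : nat -> R) (l b : R) :
  is_lim_seq u l -> eventually (fun n => Rabs (u n) <= b) -> Rabs l <= b.
Proof.
  intros Hu Hb.
  apply (is_lim_seq_le_loc (fun n => Rabs (u n)) (fun _ => b) (Rabs l) b).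
  - exact Hb.
  - apply (is_lim_seq_abs u l Hu).
  - apply is_lim_seq_const.
Qed.

(** Tannery's theorem. *)
Lemma dominated_series (t : nat -> nat -> R) (T b : nat -> R) :
  (forall m, is_lim_seq (fun n => t n m) (T m)) ->
  (forall n m, Rabs (t n m) <= b m) -> ex_series b ->
  is_lim_seq (fun n => Series (t n)) (Series T).
Proof.
  intros Ht Hb Hex.
  assert (HT : forall m, Rabs (T m) <= b m).
  { intros m. apply is_lim_seq_Rabs_le with (1 := Ht m).
    exists 0%nat. intros n _. apply Hb. }
  apply is_lim_seq_spec. intros eps.
  destruct (series_tail_small b (eps / 3) Hex) as [M HM].
  { destruct eps as [e He]; simpl; lra. }
  assert (Hfin := is_lim_seq_sum_f_R0 t T M Ht).
  apply is_lim_seq_spec in Hfin.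
  assert (He3 : 0 < eps / 3) by (destruct eps as [e He]; simpl; lra).
  destruct (Hfin (mkposreal _ He3)) as [n0 Hn0]. exists n0. intros n Hn.
  specialize (Hn0 n Hn). simpl in Hn0.
  assert (Hexb : ex_series (fun k => b (S M + k)%nat)) by (apply (ex_series_incr_n b), Hex).
  assert (E : forall a : nat -> R, (forall m, Rabs (a m) <= b m) ->
    exists r, Series a = sum_f_R0 a M + r /\ Rabs r < eps / 3).
  { intros a Ha. exists (Series (fun k => a (S M + k)%nat)). split.
    - apply (Series_incr_n a (S M)); [lia|]. apply ex_series_le_Rabs with b; assumption.
    - apply Rle_lt_trans with (2 := HM).
      apply Rle_trans with (Series (fun k => b (S M + k)%nat)); [|apply Rle_abs].
      apply Series_Rabs_le; [|exact Hexb]. intros m. apply Ha. }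
  destruct (E (t n) (Hb n)) as (r1 & E1 & Hr1).
  destruct (E T HT) as (r2 & E2 & Hr2).
  rewrite E1, E2.
  apply Rabs_lt_between in Hn0, Hr1, Hr2. apply Rabs_lt_between. lra.
Qed.

Fixpoint sumn (f : nat -> R) (n : nat) : R :=
  match n with
  | O => 0
  | S k => sumn f k + f k
  end.

Lemma sumn_sum_f_R0 (f : nat -> R) (n : nat) : sumn f (S n) = sum_f_R0 f n.
Proof.
  induction n as [|n IH]; [simpl; ring|]. rewrite tech5, <- IH. reflexivity.
Qed.

Lemma sumn_le (f : nat -> R) (m n : nat) :
  (forall k, 0 <= f k) -> (m <= n)%nat -> sumn f m <= sumn f n.
Proof.
  intros Hf H. induction H as [|n H IH]; [lra|]. simpl. specialize (Hf n). lra.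
Qed.

Lemma prodn_bound (y b : nat -> R) (n : nat) :
  (forall k, (k < n)%nat -> Rabs (y k) <= b k) ->
  Rabs (prodn (fun k => 1 - y k) n) <= exp (sumn b n).
Proof.
  induction n as [|n IH]; intros H; simpl.
  - rewrite Rabs_R1, exp_0. lra.
  - rewrite Rabs_mult, exp_plus. apply Rmult_le_compat; try apply Rabs_pos.
    + apply IH. intros; apply H; lia.
    + pose proof (H n ltac:(lia)) as Hn. pose proof (exp_ineq1_le (b n)).
      pose proof (Rabs_triang 1 (- y n)) as Ht. rewrite Rabs_R1, Rabs_Ropp in Ht.
      replace (1 - y n) with (1 + - y n) by ring. lra.
Qed.

(** The increment of the product at step [n] is at most [exp (sumn b n) * b n], hence
    at most the increment of the exponential of the partial sums of [b]. *)
Lemma prodn_tail (y b : nat -> R) (J n : nat) :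
  (forall k, (k < n)%nat -> Rabs (y k) <= b k) -> (J <= n)%nat ->
  Rabs (prodn (fun k => 1 - y k) n - prodn (fun k => 1 - y k) J)
  <= exp (sumn b n) - exp (sumn b J).
Proof.
  intros H HJ. induction HJ as [|n HJ IH].
  - rewrite !Rminus_diag, Rabs_R0. lra.
  - specialize (IH ltac:(intros; apply H; lia)). simpl.
    set (p := prodn (fun k => 1 - y k) n) in *.
    set (q := prodn (fun k => 1 - y k) J) in *.
    replace (p * (1 - y n) - q) with ((p - q) + - (p * y n)) by ring.
    apply Rle_trans with (1 := Rabs_triang _ _). rewrite Rabs_Ropp, Rabs_mult.
    assert (Hp : Rabs p <= exp (sumn b n)) by (apply prodn_bound; intros; apply H; lia).
    pose proof (H n ltac:(lia)) as Hn. rewrite exp_plus.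
    pose proof (exp_ineq1_le (b n)). pose proof (exp_pos (sumn b n)).
    pose proof (Rabs_pos p). pose proof (Rabs_pos (y n)). nra.
Qed.

Lemma ex_series_inv_sq : ex_series (fun k => / (INR k + 1) ^ 2).
Proof.
  assert (Hb : ex_series (fun k => 2 * (/ (INR k + 1) - / (INR k + 2)))).
  { exists 2.
    assert (E : forall n, sum_f_R0 (fun k => 2 * (/ (INR k + 1) - / (INR k + 2))) n
                          = 2 - 2 * / (INR n + 2)).
    { induction n as [|n IH]; [simpl; field|].
      rewrite tech5, IH, S_INR. pose proof (pos_INR n). field. lra. }
    change (is_lim_seq (sum_n (fun k => 2 * (/ (INR k + 1) - / (INR k + 2)))) 2).
    apply is_lim_seq_ext with (fun n => 2 - 2 * / (INR n + 2)); [intros n; rewrite sum_n_Reals; symmetry; apply E|].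
    replace (Finite 2) with (Finite (2 - 2 * 0)) by (f_equal; ring).
    apply is_lim_seq_minus'; [apply is_lim_seq_const|].
    apply (is_lim_seq_scal_l _ 2 0).
    apply (is_lim_seq_inv _ p_infty); [|discriminate].
    apply is_lim_seq_plus with p_infty 2; [apply is_lim_seq_INR|apply is_lim_seq_const|reflexivity]. }
  apply ex_series_le_Rabs with (2 := Hb). intros k. pose proof (pos_INR k).
  rewrite Rabs_pos_eq by (apply Rlt_le, Rinv_0_lt_compat; nra).
  replace (2 * (/ (INR k + 1) - / (INR k + 2))) with (2 / ((INR k + 1) * (INR k + 2)))
    by (field; lra).
  apply Rmult_le_reg_r with ((INR k + 1) ^ 2 * (INR k + 2)); [nra|].
  replace (/ (INR k + 1) ^ 2 * ((INR k + 1) ^ 2 * (INR k + 2))) with (INR k + 2)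
    by (field; lra).
  replace (2 / ((INR k + 1) * (INR k + 2)) * ((INR k + 1) ^ 2 * (INR k + 2)))
    with (2 * (INR k + 1)) by (field; lra).
  lra.
Qed.

Lemma is_lim_seq_sumn (b : nat -> R) :
  ex_series b -> is_lim_seq (sumn b) (Series b).
Proof.
  intros Hb. apply is_lim_seq_incr_1.
  apply is_lim_seq_ext with (sum_n b).
  { intros n. rewrite sumn_sum_f_R0. apply sum_n_Reals. }
  exact (Series_correct _ Hb).
Qed.

Lemma sumn_le_Series (b : nat -> R) (n : nat) :
  (forall k, 0 <= b k) -> ex_series b -> sumn b n <= Series b.
Proof.
  intros H0 Hb.
  apply (is_lim_seq_incr_compare (sumn b)); [apply is_lim_seq_sumn, Hb|].
  intros m. simpl. specialize (H0 m). lra.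
Qed.

(** * A common cluster point of countably many bounded sequences *)

Definition override (h : nat -> R) (J : nat) (y : R) (j : nat) : R :=
  if Nat.eqb j J then y else h j.

(** Only the existence of indices at which the first [J] coordinates are close at the
    same time is recorded; this replaces the extraction of nested subsequences. *)
Definition clusters_below (z : nat -> nat -> R) (J : nat) (h : nat -> R) : Prop :=
  forall eps N, 0 < eps ->
    exists n, (N <= n)%nat /\ forall j, (j < J)%nat -> Rabs (z n j - h j) < eps.

(** Bolzano-Weierstrass for coordinate [J], along indices at which the previous
    coordinates converge already. *)
Lemma cluster_extend (z : nat -> nat -> R) (K : nat -> R) (J : nat) (h : nat -> R) :
  (forall n j, (j < n)%nat -> Rabs (z n j) <= K j) ->
  clusters_below z J h -> exists y, clusters_below z (S J) (override h J y).
Proof.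
  intros HK Hh.
  assert (Hi : forall i, exists n, (i + S J <= n)%nat /\
                forall j, (j < J)%nat -> Rabs (z n j - h j) < / (INR i + 1)).
  { intros i. apply Hh. apply Rinv_0_lt_compat. pose proof (pos_INR i). lra. }
  apply nat_choice in Hi as [f Hf].
  destruct (Bolzano_Weierstrass (fun i => z (f i) J) (fun c => - K J <= c <= K J)) as [l Hl].
  - apply compact_P3.
  - intros i. apply Rabs_le_between, HK. destruct (Hf i). lia.
  - exists l. intros eps N He.
    destruct (INR_unbounded (/ eps)) as [i0 Hi0].
    destruct (Hl (disc l (mkposreal eps He)) (Nat.max N i0)) as (p & Hp & Hd).
    { exists (mkposreal eps He). intros c Hc; exact Hc. }
    destruct (Hf p) as [Hfp Hj]. exists (f p). split; [lia|].
    intros j Hlt. unfold override. destruct (Nat.eqb_spec j J) as [->|Hne]; [exact Hd|].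
    apply Rlt_trans with (/ (INR p + 1)); [apply Hj; lia|].
    rewrite <- (Rinv_inv eps). apply Rinv_lt_contravar.
    + pose proof (pos_INR p). apply Rmult_lt_0_compat; [apply Rinv_0_lt_compat; exact He|lra].
    + assert (INR i0 <= INR p) by (apply le_INR; lia). lra.
Qed.

Lemma cluster_exists (z : nat -> nat -> R) (K : nat -> R) :
  (forall n j, (j < n)%nat -> Rabs (z n j) <= K j) ->
  exists h, forall J, clusters_below z J h.
Proof.
  intros HK.
  set (next := fun J h => epsilon (inhabits 0)
                 (fun y => clusters_below z (S J) (override h J y))).
  set (H := fix H J := match J with O => fun _ => 0 | S i => override (H i) i (next i (H i)) end).
  assert (HH : forall J, clusters_below z J (H J)).
  { induction J as [|J IH].
    - intros eps N _. exists N. split; [lia|]. intros j Hj; lia.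
    - simpl. unfold next. apply epsilon_spec.
      apply cluster_extend with K; assumption. }
  assert (Hst : forall J j, (j < J)%nat -> H J j = H (S j) j).
  { intros J j Hj. induction Hj as [|J Hj IH]; [reflexivity|].
    rewrite <- IH. simpl. unfold override at 1.
    destruct (Nat.eqb_spec j J); [lia|reflexivity]. }
  exists (fun j => H (S j) j). intros J eps N He.
  destruct (HH J eps N He) as (n & Hn & Hj). exists n. split; [exact Hn|].
  intros j Hlt. rewrite <- (Hst J j Hlt). apply Hj, Hlt.
Qed.

(** * The limit function and its factorization *)

(** The ratio of consecutive terms is the definition, because the finite
    approximations have ratios converging to these. *)
Fixpoint hyp_term (lam x : R) (m : nat) : R :=
  match m with
  | O => 1
  | S k => hyp_term lam x k
           * (- x ^ 2 / ((2 * INR k + 3) * (2 * INR k + 2))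
              * ((INR k + 1) / (lam + INR k + 1)))
  end.

Definition hyp (lam x : R) : R := Series (hyp_term lam x).

(** The terms of [approx], with the factor [4 * (N + 1) ^ 2] put next to [s] so that
    each factor has a limit when [s = sin (x / (2 (N + 1))) ^ 2]. *)
Fixpoint approx_term (lam : R) (N : nat) (s : R) (m : nat) : R :=
  match m with
  | O => 1
  | S k => approx_term lam N s k
           * (- (4 * (INR N + 1) ^ 2 * s) / ((2 * INR k + 3) * (2 * INR k + 2))
              * ((INR k + 1) / (lam + INR k + 1))
              * ((INR N - INR k) * (INR N + lam + INR k + 1) / (INR N + 1) ^ 2))
  end.

Lemma approx_term_S (lam : R) (N : nat) (s : R) (m : nat) :
  approx_term lam N s (S m)
  = approx_term lam N s m
    * (- (4 * (INR N + 1) ^ 2 * s) / ((2 * INR m + 3) * (2 * INR m + 2))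
       * ((INR m + 1) / (lam + INR m + 1))
       * ((INR N - INR m) * (INR N + lam + INR m + 1) / (INR N + 1) ^ 2)).
Proof. reflexivity. Qed.

Lemma approx_term_correct (lam : R) (N : nat) (s : R) (m : nat) :
  0 < lam ->
  (- 4 * s) ^ m / INR (fact (2 * m + 1)) * moment lam N m = approx_term lam N s m.
Proof.
  intros Hl. induction m as [|m IH].
  - simpl. rewrite moment_0 by exact Hl. field.
  - rewrite approx_term_S, <- IH, fact_odd_S.
    pose proof (moment_S lam N m Hl) as H. pose proof (pos_INR m). pose proof (pos_INR N).
    assert (E : moment lam N (S m) = (INR m + 1) * (INR N - INR m) * (INR N + lam + INR m + 1)
                  * moment lam N m / (lam + INR m + 1)).
    { rewrite <- H. field. lra. }
    rewrite E. simpl pow. pose proof (INR_fact_neq_0 (2 * m + 1)).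
    field. repeat split; try assumption; lra.
Qed.

Lemma approx_term_vanish (lam : R) (N : nat) (s : R) (m : nat) :
  (N < m)%nat -> approx_term lam N s m = 0.
Proof.
  induction m as [|m IH]; intros H; [lia|]. simpl.
  destruct (Nat.eq_dec N m) as [->|Hn].
  - unfold Rdiv. ring.
  - rewrite IH by lia. ring.
Qed.

Lemma approx_series (lam : R) (N : nat) (s : R) :
  0 < lam -> approx lam N s = Series (approx_term lam N s).
Proof.
  intros Hl. symmetry. apply is_series_unique.
  change (is_lim_seq (sum_n (approx_term lam N s)) (approx lam N s)).
  apply is_lim_seq_ext_loc with (fun _ => approx lam N s); [|apply is_lim_seq_const].
  exists N. intros n Hn. rewrite sum_n_Reals.
  induction Hn as [|n Hn IH].
  - apply sum_eq. intros m _. apply approx_term_correct, Hl.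
  - rewrite tech5, <- IH, approx_term_vanish by lia. ring.
Qed.

(** The Taylor terms of [sinh x / x], which dominate all the series below. *)
Definition sinh_term (x : R) (m : nat) : R := x ^ (2 * m) / INR (fact (2 * m + 1)).

Lemma sinh_term_S (x : R) (m : nat) :
  sinh_term x (S m) = sinh_term x m * (x ^ 2 / ((2 * INR m + 3) * (2 * INR m + 2))).
Proof.
  unfold sinh_term. rewrite fact_odd_S.
  replace (2 * S m)%nat with (2 + 2 * m)%nat by lia. rewrite pow_add.
  pose proof (INR_fact_neq_0 (2 * m + 1)). pose proof (pos_INR m). field. lra.
Qed.

Lemma sinh_term_pos (x : R) (m : nat) : 0 <= sinh_term x m.
Proof.
  unfold sinh_term. rewrite pow_mult.
  apply Rdiv_le_0_compat; [apply pow_le, pow2_ge_0|apply INR_fact_lt_0].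
Qed.

Lemma is_lim_seq_INR_plus (c : R) : is_lim_seq (fun n => INR n + c) p_infty.
Proof.
  apply is_lim_seq_plus with p_infty c;
    [apply is_lim_seq_INR|apply is_lim_seq_const|reflexivity].
Qed.

Lemma is_lim_seq_double_INR_plus (c : R) : is_lim_seq (fun n => 2 * (INR n + c)) p_infty.
Proof.
  assert (E : is_Rbar_mult 2 p_infty p_infty)
    by (apply is_Rbar_mult_sym, is_Rbar_mult_p_infty_pos; simpl; lra).
  rewrite <- (is_Rbar_mult_unique _ _ _ E).
  apply is_lim_seq_scal_l, is_lim_seq_INR_plus.
Qed.

Lemma is_lim_seq_inv_infty (u : nat -> R) :
  is_lim_seq u p_infty -> is_lim_seq (fun n => / u n) 0.
Proof. intros H. apply (is_lim_seq_inv u p_infty); [exact H|discriminate]. Qed.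

Lemma ex_series_sinh_term (x : R) : ex_series (sinh_term x).
Proof.
  destruct (Req_dec x 0) as [->|Hx].
  - exists 1. change (is_lim_seq (sum_n (sinh_term 0)) 1).
    apply is_lim_seq_ext with (fun _ => 1); [|apply is_lim_seq_const].
    intros n. rewrite sum_n_Reals. symmetry. induction n as [|n IH].
    + unfold sinh_term. simpl. field.
    + rewrite tech5, IH, sinh_term_S. simpl. unfold Rdiv. ring.
  - apply ex_series_Rabs. apply ex_series_DAlembert with 0; [lra| |].
    + intros m. unfold sinh_term. apply Rmult_integral_contrapositive_currified.
      * apply pow_nonzero, Hx.
      * apply Rinv_neq_0_compat, INR_fact_neq_0.
    + apply is_lim_seq_ext with
        (fun m => x ^ 2 * (/ (2 * (INR m + 3 / 2)) * / (2 * (INR m + 1)))).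
      { intros m. rewrite sinh_term_S. pose proof (pos_INR m).
        assert (sinh_term x m <> 0).
        { unfold sinh_term. apply Rmult_integral_contrapositive_currified.
          - apply pow_nonzero, Hx.
          - apply Rinv_neq_0_compat, INR_fact_neq_0. }
        rewrite Rabs_pos_eq.
        - field. lra.
        - replace (sinh_term x m * (x ^ 2 / ((2 * INR m + 3) * (2 * INR m + 2))) / sinh_term x m)
            with (x ^ 2 / ((2 * INR m + 3) * (2 * INR m + 2))) by (field; lra).
          apply Rdiv_le_0_compat; [apply pow2_ge_0|nra]. }
      assert (H : forall c, is_lim_seq (fun m => / (2 * (INR m + c))) 0).
      { intros c. apply is_lim_seq_inv_infty, is_lim_seq_double_INR_plus. }
      replace (Finite 0) with (Finite (x ^ 2 * (0 * 0))) by (f_equal; ring).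
      apply (is_lim_seq_scal_l _ (x ^ 2) (0 * 0)).
      apply is_lim_seq_mult'; apply H.
Qed.

(** By the arithmetic-geometric mean inequality
    [(N - m) * (N + lam + m + 1) <= (N + 1) ^ 2], so each ratio is at most that of
    [sinh_term]; beyond [m = N] the terms vanish. *)
Lemma approx_term_bound (lam : R) (N : nat) (s x : R) (m : nat) :
  0 < lam < 1 -> 0 <= 4 * (INR N + 1) ^ 2 * s <= x ^ 2 ->
  Rabs (approx_term lam N s m) <= sinh_term x m.
Proof.
  intros Hl Hs. induction m as [|m IH].
  - simpl. rewrite Rabs_R1. unfold sinh_term. simpl. lra.
  - destruct (le_lt_dec m N) as [H|H].
    + rewrite approx_term_S, sinh_term_S, Rabs_mult.
      apply Rmult_le_compat; try apply Rabs_pos; [exact IH|].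
      apply le_INR in H. pose proof (pos_INR m) as Hm.
      set (q := 4 * (INR N + 1) ^ 2 * s) in *. set (n := INR N) in *. set (k := INR m) in *.
      replace (- q / ((2 * k + 3) * (2 * k + 2)) * ((k + 1) / (lam + k + 1))
               * ((n - k) * (n + lam + k + 1) / (n + 1) ^ 2))
        with (- (q / ((2 * k + 3) * (2 * k + 2)) * ((k + 1) / (lam + k + 1)
               * ((n - k) * (n + lam + k + 1) / (n + 1) ^ 2)))) by (field; lra).
      rewrite Rabs_Ropp.
      assert (HA : 0 <= q / ((2 * k + 3) * (2 * k + 2)) <= x ^ 2 / ((2 * k + 3) * (2 * k + 2))).
      { split.
        - apply Rdiv_le_0_compat; [lra|nra].
        - apply Rmult_le_compat_r; [apply Rlt_le, Rinv_0_lt_compat; nra|lra]. }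
      assert (HB : 0 <= (k + 1) / (lam + k + 1) <= 1).
      { split; [apply Rdiv_le_0_compat; lra|]. apply Rle_div_l; lra. }
      assert (HC : 0 <= (n - k) * (n + lam + k + 1) / (n + 1) ^ 2 <= 1).
      { split; [apply Rdiv_le_0_compat; nra|]. apply Rle_div_l; [nra|].
        pose proof (pow2_ge_0 (lam + 2 * k + 1)). nra. }
      revert HA HB HC.
      generalize (q / ((2 * k + 3) * (2 * k + 2))) ((k + 1) / (lam + k + 1))
        ((n - k) * (n + lam + k + 1) / (n + 1) ^ 2).
      intros A B C HA HB HC.
      assert (0 <= B * C <= 1) by nra.
      rewrite Rabs_pos_eq by nra. nra.
    + rewrite approx_term_vanish by lia. rewrite Rabs_R0. apply sinh_term_pos.
Qed.

Lemma Rabs_sin_le (x : R) : Rabs (sin x) <= Rabs x.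
Proof.
  assert (H : forall y, 0 <= y -> Rabs (sin y) <= y).
  { intros y [Hy|<-]; [|rewrite sin_0, Rabs_R0; lra].
    pose proof (sin_lt_x y Hy). pose proof PI_RGT_0. pose proof (SIN_bound y).
    pose proof PI2_3_2.
    destruct (Rle_dec y PI).
    - rewrite Rabs_pos_eq; [lra|]. apply sin_ge_0; lra.
    - apply Rabs_le. lra. }
  destruct (Rle_dec 0 x) as [Hx|Hx].
  - rewrite (Rabs_pos_eq x Hx). apply H, Hx.
  - rewrite <- Rabs_Ropp, <- sin_neg, <- (Rabs_Ropp x), (Rabs_pos_eq (- x)) by lra.
    apply H. lra.
Qed.

Lemma sin_ge_third (x : R) : 0 <= x <= PI / 2 -> x / 3 <= sin x.
Proof.
  intros Hx. pose proof PI_4. pose proof PI_RGT_0.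
  destruct (pre_sin_bound x 0) as [H1 _]; [lra|lra|].
  apply Rle_trans with (2 := H1).
  unfold sin_approx, sin_term. simpl.
  match goal with |- _ <= ?e => replace e with (x * (1 - x ^ 2 / 6)) by field end.
  assert (x ^ 2 <= 4) by nra. nra.
Qed.

(** Continuity at 0 of [sin y / y], extended by the value 1. *)
Lemma is_lim_seq_mult_sin (L w : nat -> R) (l : R) :
  (forall n, 0 < L n) -> is_lim_seq L p_infty -> is_lim_seq w l ->
  is_lim_seq (fun n => L n * sin (w n / L n)) l.
Proof.
  intros HL Hinf Hw.
  set (S := fun y => if Req_EM_T y 0 then 1 else sin y / y).
  assert (HS : is_lim S 0 1).
  { apply is_lim_ext_loc with (2 := is_lim_sinc_0).
    exists (mkposreal 1 Rlt_0_1). intros y _ Hy. unfold S.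
    destruct (Req_EM_T y 0); [contradiction|reflexivity]. }
  apply is_lim_seq_ext with (fun n => w n * S (w n / L n)).
  { intros n. specialize (HL n). unfold S. destruct (Req_EM_T (w n / L n) 0) as [E|E].
    - rewrite E, sin_0. replace (w n) with (w n / L n * L n) by (field; lra).
      rewrite E. ring.
    - assert (w n <> 0) by (intros H; apply E; rewrite H; unfold Rdiv; ring).
      field. lra. }
  replace (Finite l) with (Finite (l * 1)) by (f_equal; ring).
  apply is_lim_seq_mult'; [exact Hw|].
  assert (E : S 0 = 1) by (unfold S; destruct (Req_EM_T 0 0); [reflexivity|contradiction]).
  assert (Hc : continuity_pt S 0).
  { apply continuity_pt_filterlim. rewrite E. apply is_lim_spec in HS. intros P [eps HP].
    destruct (HS eps) as [d Hd]. exists d. intros y Hy. apply HP.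
    destruct (Req_dec y 0) as [->|Hy0]; [rewrite E; apply ball_center|].
    apply (Hd y Hy Hy0). }
  rewrite <- E. apply is_lim_seq_continuous; [exact Hc|].
  replace (Finite 0) with (Finite (l * 0)) by (f_equal; ring).
  apply is_lim_seq_mult'; [exact Hw|]. apply is_lim_seq_inv_infty, Hinf.
Qed.

Definition scale (N : nat) : R := 2 * (INR N + 1).

Lemma scale_pos (N : nat) : 0 < scale N.
Proof. unfold scale. pose proof (pos_INR N). lra. Qed.

Lemma is_lim_seq_scale : is_lim_seq scale p_infty.
Proof.
  apply is_lim_seq_double_INR_plus.
Qed.

Lemma scale_sin_bound (N : nat) (x : R) :
  0 <= 4 * (INR N + 1) ^ 2 * sin (x / scale N) ^ 2 <= x ^ 2.
Proof.
  replace (4 * (INR N + 1) ^ 2 * sin (x / scale N) ^ 2)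
    with ((scale N * sin (x / scale N)) ^ 2) by (unfold scale; ring).
  split; [apply pow2_ge_0|].
  rewrite <- (pow2_abs x), <- (pow2_abs (_ * _)). apply pow_incr.
  split; [apply Rabs_pos|]. pose proof (scale_pos N).
  rewrite Rabs_mult, (Rabs_pos_eq (scale N)) by lra.
  apply Rle_trans with (scale N * Rabs (x / scale N)).
  - apply Rmult_le_compat_l; [lra|apply Rabs_sin_le].
  - unfold Rdiv. rewrite Rabs_mult, Rabs_inv, (Rabs_pos_eq (scale N)) by lra.
    right. field. lra.
Qed.

Lemma is_lim_seq_ratio (lamn : nat -> R) (lam : R) (k : nat) :
  is_lim_seq lamn lam ->
  is_lim_seq (fun n => (INR n - INR k) * (INR n + lamn n + INR k + 1) / (INR n + 1) ^ 2) 1.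
Proof.
  intros Hl.
  assert (Hi : is_lim_seq (fun n => / (INR n + 1)) 0)
    by apply is_lim_seq_inv_infty, is_lim_seq_INR_plus.
  apply is_lim_seq_ext with (fun n =>
    (1 - (INR k + 1) * / (INR n + 1)) * (1 + (lamn n + INR k) * / (INR n + 1))).
  { intros n. pose proof (pos_INR n). field. lra. }
  replace (Finite 1) with (Finite ((1 - (INR k + 1) * 0) * (1 + (lam + INR k) * 0)))
    by (f_equal; ring).
  apply is_lim_seq_mult'.
  - apply is_lim_seq_minus'; [apply is_lim_seq_const|].
    apply is_lim_seq_mult'; [apply is_lim_seq_const|exact Hi].
  - apply is_lim_seq_plus'; [apply is_lim_seq_const|].
    apply is_lim_seq_mult'; [|exact Hi].
    apply is_lim_seq_plus'; [exact Hl|apply is_lim_seq_const].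
Qed.

Lemma approx_term_lim (lamn : nat -> R) (lam x : R) (m : nat) :
  0 <= lam -> is_lim_seq lamn lam ->
  is_lim_seq (fun n => approx_term (lamn n) n (sin (x / scale n) ^ 2) m) (hyp_term lam x m).
Proof.
  intros Hl0 Hl. induction m as [|m IH]; [apply is_lim_seq_const|].
  apply (is_lim_seq_ext _ _ _ (fun n => eq_sym (approx_term_S (lamn n) n _ m))).
  change (hyp_term lam x (S m)) with (hyp_term lam x m
     * (- x ^ 2 / ((2 * INR m + 3) * (2 * INR m + 2)) * ((INR m + 1) / (lam + INR m + 1)))).
  apply is_lim_seq_mult'; [exact IH|].
  pose proof (pos_INR m) as Hm.
  replace (Finite (- x ^ 2 / ((2 * INR m + 3) * (2 * INR m + 2))
              * ((INR m + 1) / (lam + INR m + 1))))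
    with (Finite (- x ^ 2 / ((2 * INR m + 3) * (2 * INR m + 2))
              * ((INR m + 1) / (lam + INR m + 1)) * 1)) by (f_equal; ring).
  apply is_lim_seq_mult'; [|exact (is_lim_seq_ratio lamn lam m Hl)].
  apply is_lim_seq_mult'.
  - apply is_lim_seq_mult'; [|apply is_lim_seq_const].
    apply (is_lim_seq_opp _ (x ^ 2)).
    apply is_lim_seq_ext with (fun n => (scale n * sin (x / scale n)) * (scale n * sin (x / scale n))).
    { intros n. unfold scale. ring. }
    replace (Finite (x ^ 2)) with (Finite (x * x)) by (f_equal; ring).
    apply is_lim_seq_mult'; apply (is_lim_seq_mult_sin scale (fun _ => x));
      try apply scale_pos; try apply is_lim_seq_scale; apply is_lim_seq_const.
  - apply is_lim_seq_mult'; [apply is_lim_seq_const|].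
    apply (is_lim_seq_inv _ (lam + INR m + 1)).
    + apply is_lim_seq_plus'; [|apply is_lim_seq_const].
      apply is_lim_seq_plus'; [exact Hl|apply is_lim_seq_const].
    + intros H. injection H. lra.
Qed.

Lemma approx_lim (lamn : nat -> R) (lam x : R) :
  0 <= lam -> (forall n, 0 < lamn n < 1) -> is_lim_seq lamn lam ->
  is_lim_seq (fun n => approx (lamn n) n (sin (x / scale n) ^ 2)) (hyp lam x).
Proof.
  intros Hl0 Hn Hl.
  apply is_lim_seq_ext with
    (fun n => Series (approx_term (lamn n) n (sin (x / scale n) ^ 2))).
  { intros n. symmetry. apply approx_series, Hn. }
  apply dominated_series with (sinh_term x).
  - intros m. apply approx_term_lim; assumption.
  - intros n m. apply approx_term_bound; [apply Hn|apply scale_sin_bound].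
  - apply ex_series_sinh_term.
Qed.

(** Convex combinations with 1 / 2 reach the end points 0 and 1 as limits. *)
Lemma interior_parameters (lam : R) :
  0 <= lam <= 1 ->
  exists lamn : nat -> R, (forall n, 0 < lamn n < 1) /\ is_lim_seq lamn lam.
Proof.
  intros Hl. exists (fun n => lam + (1 / 2 - lam) * / (INR n + 1)). split.
  - intros n. pose proof (pos_INR n).
    assert (H1 : 0 < / (INR n + 1)) by (apply Rinv_0_lt_compat; lra).
    assert (H2 : / (INR n + 1) <= 1) by (rewrite <- Rinv_1; apply Rinv_le_contravar; lra).
    set (t := / (INR n + 1)) in *.
    replace (lam + (1 / 2 - lam) * t) with (lam * (1 - t) + t / 2) by field. nra.
  - replace (Finite lam) with (Finite (lam + (1 / 2 - lam) * 0)) by (f_equal; ring).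
    apply is_lim_seq_plus'; [apply is_lim_seq_const|].
    apply is_lim_seq_mult'; [apply is_lim_seq_const|].
    apply is_lim_seq_inv_infty, is_lim_seq_INR_plus.
Qed.

Lemma exp_sumn_gap (b : nat -> R) :
  ex_series b -> is_lim_seq (fun J => exp (Series b) - exp (sumn b J)) 0.
Proof.
  intros Hb.
  replace (Finite 0) with (Finite (exp (Series b) - exp (Series b))) by (f_equal; ring).
  apply is_lim_seq_minus'; [apply is_lim_seq_const|].
  apply is_lim_seq_continuous; [|apply is_lim_seq_sumn, Hb].
  apply derivable_continuous_pt, derivable_pt_exp.
Qed.

(** Tannery's theorem for products whose number of factors grows. *)
Lemma dominated_product (F : nat -> R) (l : R) (n : nat -> nat)
    (y : nat -> nat -> R) (Y b : nat -> R) :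
  is_lim_seq F l ->
  (forall i, F i = prodn (fun j => 1 - y i j) (n i)) ->
  (forall i, (i <= n i)%nat) ->
  (forall i j, (j < n i)%nat -> Rabs (y i j) <= b j) ->
  (forall j, is_lim_seq (fun i => y i j) (Y j)) ->
  (forall j, 0 <= b j) -> ex_series b ->
  is_lim_seq (fun J => prodn (fun j => 1 - Y j) J) l.
Proof.
  intros HF E Hn Hy HY Hb0 Hb.
  assert (Hgap : forall J, Rabs (prodn (fun j => 1 - Y j) J - l)
                           <= exp (Series b) - exp (sumn b J)).
  { intros J. apply is_lim_seq_Rabs_le with (fun i => prodn (fun j => 1 - y i j) J - F i).
    - apply is_lim_seq_minus'; [|exact HF].
      induction J as [|J IH]; simpl; [apply is_lim_seq_const|].
      apply is_lim_seq_mult'; [exact IH|].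
      apply is_lim_seq_minus'; [apply is_lim_seq_const|apply HY].
    - exists J. intros i Hi. rewrite E, Rabs_minus_sym.
      specialize (Hn i).
      apply Rle_trans with (1 := prodn_tail (y i) b J (n i) (Hy i) ltac:(lia)).
      assert (exp (sumn b (n i)) <= exp (Series b)); [|lra].
      apply exp_le_mono, sumn_le_Series; assumption. }
  apply is_lim_seq_spec. intros eps.
  pose proof (exp_sumn_gap b Hb) as Hg. apply is_lim_seq_spec in Hg.
  destruct (Hg eps) as [J0 HJ0]. exists J0. intros J HJ. specialize (HJ0 J HJ).
  apply Rle_lt_trans with (1 := Hgap J). rewrite Rminus_0_r in HJ0.
  apply Rle_lt_trans with (2 := HJ0). apply Rle_abs.
Qed.

Lemma scaled_root_bounds (N j : nat) (ph : R) :
  (j < N)%nat -> node N (j + 1) < ph < node N (j + 2) ->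
  (INR j + 1) * PI <= scale N * ph <= (INR j + 2) * PI /\ 0 < ph <= PI / 2.
Proof.
  intros Hj Hph. pose proof (scale_pos N) as HL. pose proof (pos_INR j).
  pose proof PI2_3_2.
  assert (En : forall m, node N m * scale N = INR m * PI).
  { intros m. unfold node. fold (scale N). field. lra. }
  pose proof (node_bounds N (j + 1) ltac:(lia)). pose proof (node_bounds N (j + 2) ltac:(lia)).
  pose proof (En (j + 1)%nat) as E1. pose proof (En (j + 2)%nat) as E2.
  rewrite plus_INR in E1, E2. change (INR 2) with 2 in E2. simpl (INR 1) in E1.
  split; [|lra]. split; nra.
Qed.

(** The rescaled roots of the approximating polynomials have a common cluster point
    [h]; along indices tending to it each factor converges. The [j]-th rescaled
    root is at least [(j + 1) * PI], which dominates the factors. *)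
Theorem hyp_factorization (lam : R) :
  0 <= lam <= 1 ->
  exists h : nat -> R,
    (forall j, h j <= h (S j)) /\ (forall j, INR j + 1 <= h j) /\
    forall x, is_lim_seq (prodn (fun j => 1 - x ^ 2 / h j ^ 2)) (hyp lam x).
Proof.
  intros Hlam. destruct (interior_parameters lam Hlam) as (lamn & Hlamn & Hlim).
  destruct (nat_choice (nat -> R) (fun N ph =>
    (forall j, (j < N)%nat -> node N (j + 1) < ph j < node N (j + 2)) /\
    forall s, approx (lamn N) N s = prodn (fun j => 1 - s / sin (ph j) ^ 2) N)) as [ph Hph].
  { intros N. apply approx_factorization, Hlamn. }
  set (z := fun N j => scale N * ph N j).
  assert (Hz : forall N j, (j < N)%nat ->
      (INR j + 1) * PI <= z N j <= (INR j + 2) * PI /\ 0 < ph N j <= PI / 2).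
  { intros N j Hj. apply scaled_root_bounds; [exact Hj|]. apply Hph, Hj. }
  destruct (cluster_exists z (fun j => (INR j + 2) * PI)) as [h Hh].
  { intros N j Hj. destruct (Hz N j Hj) as (H & _). pose proof (pos_INR j).
    pose proof PI_RGT_0. apply Rabs_le. nra. }
  destruct (nat_choice nat (fun i N => (i <= N)%nat /\
     forall j, (j < i)%nat -> Rabs (z N j - h j) < / (INR i + 1))) as [n Hn].
  { intros i. apply Hh. apply Rinv_0_lt_compat. pose proof (pos_INR i). lra. }
  assert (Hzh : forall j, is_lim_seq (fun i => z (n i) j) (h j)).
  { intros j. apply is_lim_seq_spec. intros eps.
    pose proof (is_lim_seq_inv_infty _ (is_lim_seq_INR_plus 1)) as Hi.
    apply is_lim_seq_spec in Hi. destruct (Hi eps) as [i0 Hi0].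
    exists (Nat.max i0 (S j)). intros i Hge.
    apply Rlt_trans with (/ (INR i + 1)); [apply Hn; lia|].
    specialize (Hi0 i ltac:(lia)). rewrite Rminus_0_r in Hi0.
    apply Rle_lt_trans with (2 := Hi0). apply Rle_abs. }
  assert (Hni : forall i, (i <= n i)%nat) by (intros i; apply Hn).
  assert (Hlow : forall j, (INR j + 1) * PI <= h j).
  { intros j.
    apply (is_lim_seq_le_loc (fun _ => (INR j + 1) * PI) (fun i => z (n i) j)
             ((INR j + 1) * PI) (h j)); [|apply is_lim_seq_const|apply Hzh].
    exists (S j). intros i Hi. specialize (Hni i).
    destruct (Hz (n i) j ltac:(lia)) as (H & _). apply H. }
  pose proof PI2_3_2 as HPI.
  assert (Hj1 : forall j, INR j + 1 <= h j).
  { intros j. specialize (Hlow j). pose proof (pos_INR j). nra. }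
  exists h. split; [|split; [exact Hj1|]].
  - intros j.
    apply (is_lim_seq_le_loc (fun i => z (n i) j) (fun i => z (n i) (S j)) (h j) (h (S j)));
      [|apply Hzh|apply Hzh].
    exists (S (S j)). intros i Hi. specialize (Hni i).
    destruct (Hz (n i) j ltac:(lia)) as (H1 & _).
    destruct (Hz (n i) (S j) ltac:(lia)) as (H2 & _).
    rewrite S_INR in H2. lra.
  - intros x.
    apply dominated_product with
      (F := fun i => approx (lamn (n i)) (n i) (sin (x / scale (n i)) ^ 2)) (n := n)
      (y := fun i j => sin (x / scale (n i)) ^ 2 / sin (ph (n i) j) ^ 2)
      (b := fun j => x ^ 2 * / (INR j + 1) ^ 2).
    + apply (is_lim_seq_subseq
        (fun N => approx (lamn N) N (sin (x / scale N) ^ 2)) (hyp lam x) n).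
      * intros P [N0 HP]. exists N0. intros i Hi. apply HP. specialize (Hni i). lia.
      * apply approx_lim; tauto.
    + intros i. apply Hph.
    + exact Hni.
    + intros i j Hj. destruct (Hz (n i) j Hj) as (Hzj & Hb).
      pose proof (pos_INR j) as Hjpos.
      pose proof (sin_ge_third (ph (n i) j) ltac:(lra)) as Hs.
      pose proof (scale_sin_bound (n i) x) as Hx.
      pose proof (scale_pos (n i)) as HL.
      set (L := scale (n i)) in *. set (p := ph (n i) j) in *. unfold z in Hzj. fold L p in Hzj.
      assert (E4 : 4 * (INR (n i) + 1) ^ 2 = L ^ 2) by (unfold L, scale; ring).
      rewrite E4 in Hx.
      assert (Hsp : 0 < sin p) by lra.
      rewrite Rabs_pos_eq by (apply Rdiv_le_0_compat; [apply pow2_ge_0|nra]).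
      (* By [sin p >= p / 3] and [L * p >= (j + 1) * PI], since [PI > 3]. *)
      assert (Hden : INR j + 1 <= L * sin p) by nra.
      replace (sin (x / L) ^ 2 / sin p ^ 2) with (L ^ 2 * sin (x / L) ^ 2 * / (L * sin p) ^ 2)
        by (field; lra).
      apply Rmult_le_compat; [apply Hx|apply Rlt_le, Rinv_0_lt_compat; nra|apply Hx|].
      apply Rinv_le_contravar; [nra|]. apply pow_incr. lra.
    + intros j.
      pose proof (pos_INR j) as Hjpos. specialize (Hj1 j).
      assert (Hsub : is_lim_seq (fun i => scale (n i)) p_infty).
      { apply (is_lim_seq_subseq scale p_infty n); [|apply is_lim_seq_scale].
        intros P [N0 HP]. exists N0. intros i Hi. apply HP. specialize (Hni i). lia. }
      apply is_lim_seq_ext with (fun i =>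
        (scale (n i) * sin (x / scale (n i))) ^ 2
        * / (scale (n i) * sin (z (n i) j / scale (n i))) ^ 2).
      { intros i. pose proof (scale_pos (n i)). unfold z.
        replace (scale (n i) * ph (n i) j / scale (n i)) with (ph (n i) j) by (field; lra).
        rewrite !Rpow_mult_distr, Rinv_mult.
        generalize (sin (x / scale (n i))). intros u. unfold Rdiv.
        generalize (/ sin (ph (n i) j) ^ 2). intros t. field. lra. }
      assert (Hpow : forall u l, is_lim_seq u (Finite l) -> is_lim_seq (fun i => u i ^ 2) (l ^ 2)).
      { intros u l Hu. apply is_lim_seq_ext with (fun i => u i * u i); [intros; ring|].
        replace (Finite (l ^ 2)) with (Finite (l * l)) by (f_equal; ring).
        apply is_lim_seq_mult'; exact Hu. }
      apply is_lim_seq_mult'.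
      * apply Hpow, (is_lim_seq_mult_sin _ (fun _ => x)); [intros; apply scale_pos|exact Hsub|].
        apply is_lim_seq_const.
      * apply (is_lim_seq_inv _ (h j ^ 2)).
        -- apply Hpow, is_lim_seq_mult_sin; [intros; apply scale_pos|exact Hsub|apply Hzh].
        -- intros H. injection H as H. nra.
    + intros j. apply Rmult_le_pos; [apply pow2_ge_0|].
      apply Rlt_le, Rinv_0_lt_compat. pose proof (pos_INR j). nra.
    + apply (ex_series_scal_l (V := R_NormedModule) (x ^ 2)). apply ex_series_inv_sq.
Qed.

(** * Multiplicities *)

(** A multiplicity that does not mention derivatives, so that it can be read off
    from a product and passes to limits. *)
Definition comparable_power (f : R -> R) (a : R) (m : nat) : Prop :=
  exists c C, 0 < c /\
    locally a (fun x => c * Rabs (x - a) ^ m <= Rabs (f x) <= C * Rabs (x - a) ^ m).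

Lemma comparable_power_mult (f g : R -> R) (a : R) (m k : nat) :
  comparable_power f a m -> comparable_power g a k ->
  comparable_power (fun x => f x * g x) a (m + k).
Proof.
  intros (c & C & Hc & Hf) (d & D & Hd & Hg). exists (c * d), (C * D).
  split; [apply Rmult_lt_0_compat; assumption|].
  generalize (filter_and _ _ Hf Hg). apply filter_imp. intros x [[H1 H2] [H3 H4]].
  rewrite pow_add, Rabs_mult.
  assert (0 <= Rabs (x - a) ^ m) by apply pow_le, Rabs_pos.
  assert (0 <= Rabs (x - a) ^ k) by apply pow_le, Rabs_pos.
  replace (c * d * (Rabs (x - a) ^ m * Rabs (x - a) ^ k))
    with (c * Rabs (x - a) ^ m * (d * Rabs (x - a) ^ k)) by ring.
  replace (C * D * (Rabs (x - a) ^ m * Rabs (x - a) ^ k))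
    with (C * Rabs (x - a) ^ m * (D * Rabs (x - a) ^ k)) by ring.
  split; apply Rmult_le_compat; try assumption; try apply Rabs_pos; nra.
Qed.

Lemma comparable_power_0 (f : R -> R) (a : R) :
  continuous f a -> f a <> 0 -> comparable_power f a 0.
Proof.
  intros Hf Ha. apply Rabs_pos_lt in Ha.
  exists (Rabs (f a) / 2), (2 * Rabs (f a)). split; [lra|].
  assert (He : 0 < Rabs (f a) / 2) by lra.
  specialize (Hf (fun y => Rabs (y - f a) < Rabs (f a) / 2)).
  assert (H : locally a (fun x => Rabs (f x - f a) < Rabs (f a) / 2)).
  { apply Hf. exists (mkposreal _ He). intros y Hy. exact Hy. }
  revert H. apply filter_imp. intros x Hx. simpl.
  pose proof (Rabs_triang_inv (f x) (f a)). pose proof (Rabs_triang_inv (f a) (f x)).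
  rewrite (Rabs_minus_sym (f a)) in H0. lra.
Qed.

Lemma comparable_power_factor (a : R) :
  0 < a -> comparable_power (fun x => 1 - x ^ 2 / a ^ 2) a 1.
Proof.
  intros Ha. exists (/ a), (3 / a). split; [apply Rinv_0_lt_compat, Ha|].
  exists (mkposreal a Ha). intros x Hx. change (Rabs (x - a) < a) in Hx.
  apply Rabs_lt_between in Hx.
  replace (1 - x ^ 2 / a ^ 2) with (- ((x - a) * ((x + a) / a ^ 2))) by (field; lra).
  rewrite Rabs_Ropp, Rabs_mult, pow_1, (Rabs_pos_eq (_ / _))
    by (apply Rdiv_le_0_compat; nra).
  assert (H : / a <= (x + a) / a ^ 2 <= 3 / a).
  { split; apply Rmult_le_reg_r with (a ^ 2); try nra.
    - replace (/ a * a ^ 2) with a by (field; lra).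
      replace ((x + a) / a ^ 2 * a ^ 2) with (x + a) by (field; lra). lra.
    - replace (3 / a * a ^ 2) with (3 * a) by (field; lra).
      replace ((x + a) / a ^ 2 * a ^ 2) with (x + a) by (field; lra). lra. }
  pose proof (Rabs_pos (x - a)). nra.
Qed.

Definition index_list (h : nat -> R) (a : R) (J : nat) : list nat :=
  filter (fun j => if Req_EM_T (h j) a then true else false) (seq 0 J).

Lemma comparable_power_prodn (h : nat -> R) (a : R) (J : nat) :
  0 < a -> (forall j, 0 < h j) ->
  comparable_power (fun x => prodn (fun j => 1 - x ^ 2 / h j ^ 2) J) a
    (length (index_list h a J)).
Proof.
  intros Ha Hh. induction J as [|J IH].
  - apply comparable_power_0; [apply continuous_const|simpl; lra].
  - unfold index_list. rewrite seq_S, filter_app, length_app. simpl plus.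
    apply comparable_power_mult; [exact IH|]. specialize (Hh J). simpl.
    destruct (Req_EM_T (h J) a) as [->|Hne].
    + exact (comparable_power_factor a Ha).
    + apply (comparable_power_0 (fun x => 1 - x ^ 2 / h J ^ 2)).
      * apply derivable_continuous. auto_derive. exact I.
      * intros E.
        assert (E2 : (h J - a) * (h J + a) = 0).
        { replace ((h J - a) * (h J + a)) with ((1 - a ^ 2 / h J ^ 2) * h J ^ 2)
            by (field; lra). rewrite E. ring. }
        apply Rmult_integral in E2 as [E2|E2]; [apply Hne|]; lra.
Qed.

(** For the factors from [J] on, this is the inequality between a product of terms
    [1 - b k] and 1 minus the sum of the [b k]. *)
Lemma prodn_tail_lower (y b : nat -> R) (J n : nat) :
  (forall k, (J <= k)%nat -> 0 <= y k <= b k) ->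
  (J <= n)%nat -> sumn b n - sumn b J <= 1 ->
  (1 - (sumn b n - sumn b J)) * Rabs (prodn (fun k => 1 - y k) J)
  <= Rabs (prodn (fun k => 1 - y k) n) <= Rabs (prodn (fun k => 1 - y k) J).
Proof.
  intros Hy HJ. induction HJ as [|n HJ IH]; intros Hs.
  - split; [right; ring|lra].
  - simpl in *. destruct (Hy n HJ) as [H1 H2].
    assert (H0 : sumn b J <= sumn b n).
    { clear -Hy HJ. induction HJ as [|n HJ IH]; [lra|]. simpl. specialize (Hy n HJ). lra. }
    specialize (IH ltac:(lra)). rewrite Rabs_mult, (Rabs_pos_eq (1 - y n)) by lra.
    pose proof (Rabs_pos (prodn (fun k => 1 - y k) J)).
    pose proof (Rabs_pos (prodn (fun k => 1 - y k) n)).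
    set (p := Rabs (prodn (fun k => 1 - y k) J)) in *.
    set (q := Rabs (prodn (fun k => 1 - y k) n)) in *.
    set (T := sumn b n - sumn b J) in *.
    replace (sumn b n + b n - sumn b J) with (T + b n) in * by (unfold T; ring).
    split; [|nra].
    assert (HT : 0 <= T) by (unfold T; lra).
    apply Rle_trans with ((1 - T) * p * (1 - b n)).
    + assert (0 <= T * b n * p) by (repeat apply Rmult_le_pos; lra). lra.
    + apply Rmult_le_compat; try lra. apply Rmult_le_pos; lra.
Qed.

Lemma scaled_inv_sq_pos (c : R) (k : nat) : 0 <= c -> 0 <= c * / (INR k + 1) ^ 2.
Proof.
  intros Hc. pose proof (pos_INR k). apply Rmult_le_pos; [exact Hc|].
  apply Rlt_le, Rinv_0_lt_compat. nra.
Qed.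

Lemma ex_series_scaled_inv_sq (c : R) : ex_series (fun k => c * / (INR k + 1) ^ 2).
Proof. apply (ex_series_scal_l (V := R_NormedModule) c), ex_series_inv_sq. Qed.

Lemma factor_bound (h : nat -> R) (x A : R) (k : nat) :
  (forall j, INR j + 1 <= h j) -> x ^ 2 <= A ->
  0 <= x ^ 2 / h k ^ 2 <= A * / (INR k + 1) ^ 2.
Proof.
  intros Hh HA. specialize (Hh k). pose proof (pos_INR k). pose proof (pow2_ge_0 x).
  split; [apply Rdiv_le_0_compat; nra|].
  apply Rmult_le_compat; try lra.
  - apply Rlt_le, Rinv_0_lt_compat. nra.
  - apply Rinv_le_contravar; nra.
Qed.

(** A zero of the product is a zero of finitely many of its factors: the others
    together contribute between 1/2 and 1. *)
Lemma product_comparable_power (F : R -> R) (h : nat -> R) (a : R) :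
  (forall j, INR j + 1 <= h j) ->
  (forall x, is_lim_seq (prodn (fun j => 1 - x ^ 2 / h j ^ 2)) (F x)) ->
  0 < a ->
  exists J, (forall k, (J <= k)%nat -> h k <> a) /\
    comparable_power F a (length (index_list h a J)).
Proof.
  intros Hh HF Ha.
  (* [b k] bounds [x ^ 2 / h k ^ 2] for [|x - a| < 1]. *)
  set (A := (a + 1) ^ 2). set (b := fun k => A * / (INR k + 1) ^ 2).
  assert (HA : 0 <= A) by apply pow2_ge_0.
  assert (Hb0 : forall k, 0 <= b k) by (intros k; apply scaled_inv_sq_pos, HA).
  assert (Hb : ex_series b) by apply ex_series_scaled_inv_sq.
  assert (HJ : exists J, Series b - sumn b J <= 1 / 2).
  { pose proof (is_lim_seq_sumn b Hb) as H. apply is_lim_seq_spec in H.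
    destruct (H (mkposreal (1 / 2) ltac:(lra))) as [J HJ]. exists J.
    specialize (HJ J (le_n _)). simpl in HJ. apply Rabs_lt_between in HJ. lra. }
  destruct HJ as [J HJ].
  assert (Hs : forall n, sumn b n - sumn b J <= 1 / 2).
  { intros n. pose proof (sumn_le_Series b n Hb0 Hb). lra. }
  assert (Hh0 : forall j, 0 < h j) by (intros j; specialize (Hh j); pose proof (pos_INR j); lra).
  exists J. split.
  - intros k Hk E.
    assert (HaA : a ^ 2 <= A) by (unfold A; nra).
    destruct (factor_bound h a A k Hh HaA) as [_ H].
    rewrite E in H. replace (a ^ 2 / a ^ 2) with 1 in H by (field; lra).
    pose proof (Hs (S k)) as H1. simpl in H1. unfold b at 2 in H1.
    pose proof (sumn_le b J k Hb0 Hk). lra.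
  - destruct (comparable_power_prodn h a J Ha Hh0) as (c & C & Hc & Hloc).
    exists (c / 2), C. split; [lra|].
    assert (H1 : locally a (fun x => Rabs (x - a) < 1)).
    { exists (mkposreal 1 Rlt_0_1). intros x Hx. exact Hx. }
    generalize (filter_and _ _ Hloc H1). apply filter_imp. intros x [[Hl Hu] Hx].
    apply Rabs_lt_between in Hx.
    assert (HxA : x ^ 2 <= A) by (unfold A; nra).
    set (P := fun n => prodn (fun j => 1 - x ^ 2 / h j ^ 2) n) in *.
    assert (Hb2 : forall n, (J <= n)%nat ->
      1 / 2 * Rabs (P J) <= Rabs (P n) <= Rabs (P J)).
    { intros n Hn. specialize (Hs n).
      destruct (prodn_tail_lower (fun k => x ^ 2 / h k ^ 2) b J n) as [K1 K2]; [|exact Hn|lra|].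
      - intros k _. apply factor_bound; assumption.
      - fold (P n) (P J) in K1, K2. split; [|exact K2].
        apply Rle_trans with (2 := K1).
        apply Rmult_le_compat_r; [apply Rabs_pos|lra]. }
    assert (Habs : is_lim_seq (fun n => Rabs (P n)) (Rabs (F x)))
      by apply (is_lim_seq_abs P (F x)), HF.
    split.
    + apply Rle_trans with (1 / 2 * Rabs (P J)).
      { apply Rmult_le_compat_l with (r := 1 / 2) in Hl; [|lra].
        apply Rle_trans with (2 := Hl). right. field. }
      apply (is_lim_seq_le_loc (fun _ => 1 / 2 * Rabs (P J)) (fun n => Rabs (P n))
               (1 / 2 * Rabs (P J)) (Rabs (F x))); [|apply is_lim_seq_const|exact Habs].
      exists J. intros n Hn. apply Hb2, Hn.
    + apply Rle_trans with (Rabs (P J)); [|exact Hu].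
      apply is_lim_seq_Rabs_le with (1 := HF x). exists J. intros n Hn. apply Hb2, Hn.
Qed.

Lemma le_0_of_le_linear (A K eta : R) :
  0 < eta -> (forall t, 0 < t < eta -> A <= K * t) -> A <= 0.
Proof.
  intros He H. apply Rnot_lt_le. intros HA.
  pose proof (Rabs_pos K) as HK0. pose proof (Rle_abs K) as HK.
  set (t := Rmin (eta / 2) (A / (2 * (Rabs K + 1)))).
  assert (Ht : 0 < t).
  { apply Rmin_glb_lt; [lra|]. apply Rdiv_lt_0_compat; lra. }
  assert (H1 : t <= eta / 2) by apply Rmin_l.
  assert (H2 : t <= A / (2 * (Rabs K + 1))) by apply Rmin_r.
  specialize (H t ltac:(lra)).
  assert (H3 : (Rabs K + 1) * t <= A / 2).
  { apply Rle_trans with ((Rabs K + 1) * (A / (2 * (Rabs K + 1)))).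
    - apply Rmult_le_compat_l; lra.
    - right. field. lra. }
  nra.
Qed.

(** The Lagrange remainder involves the derivative of order [k + 1], which is bounded
    near [a] by continuity. *)
Lemma taylor_leading_term (f : R -> R) (a : R) (k : nat) :
  0 < a -> (forall n x, 0 < x -> ex_derive_n f n x) ->
  (forall i, (i < k)%nat -> Derive_n f i a = 0) ->
  exists C eta, 0 <= C /\ 0 < eta /\ forall t, 0 < t < eta ->
    Rabs (f (a + t) - Derive_n f k a / INR (fact k) * t ^ k) <= C * t ^ (S k).
Proof.
  intros Ha Hf Hz.
  assert (Hc : continuous (Derive_n f (S k)) a).
  { apply derivable_continuous. exact (Hf (S (S k)) a Ha). }
  assert (Hloc : locally a (fun x => Rabs (Derive_n f (S k) x - Derive_n f (S k) a) < 1)).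
  { apply (Hc (fun y => Rabs (y - Derive_n f (S k) a) < 1)).
    exists (mkposreal 1 Rlt_0_1). intros y Hy. exact Hy. }
  destruct Hloc as [eta Heta].
  set (M := Rabs (Derive_n f (S k) a) + 1).
  assert (HM : 0 <= M) by (unfold M; pose proof (Rabs_pos (Derive_n f (S k) a)); lra).
  exists (M / INR (fact (S k))), eta. pose proof (INR_fact_lt_0 (S k)) as Hfact.
  split; [apply Rdiv_le_0_compat; assumption|]. split; [apply eta|].
  intros t Ht.
  destruct (Taylor_Lagrange f k a (a + t)) as (z & Hzt & E); [lra| |].
  { intros x Hx i _. apply Hf. lra. }
  replace (a + t - a) with t in E by ring.
  assert (Es : sum_f_R0 (fun m => t ^ m / INR (fact m) * Derive_n f m a) k
               = Derive_n f k a / INR (fact k) * t ^ k).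
  { destruct k as [|k].
    - simpl. field.
    - rewrite tech5, (sum_eq _ (fun _ => 0)), sum_cte.
      + field. apply INR_fact_neq_0.
      + intros i Hi. rewrite Hz by lia. ring. }
  rewrite E, Es.
  match goal with |- Rabs ?u <= _ =>
    replace u with (t ^ S k * (/ INR (fact (S k)) * Derive_n f (S k) z)) by
      (unfold Rdiv; ring) end.
  rewrite !Rabs_mult, Rabs_inv, (Rabs_pos_eq (INR _)), (Rabs_pos_eq (t ^ _))
    by (try apply pow_le; lra).
  unfold Rdiv. rewrite (Rmult_comm (M * _)).
  apply Rmult_le_compat_l; [apply pow_le; lra|]. rewrite Rmult_comm.
  apply Rmult_le_compat_r; [apply Rlt_le, Rinv_0_lt_compat, Hfact|].
  assert (Hb : Rabs (Derive_n f (S k) z - Derive_n f (S k) a) < 1).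
  { apply Heta. change (Rabs (z - a) < eta). rewrite Rabs_pos_eq; lra. }
  pose proof (Rabs_triang_inv (Derive_n f (S k) z) (Derive_n f (S k) a)). unfold M. lra.
Qed.

Lemma comparable_power_right (f : R -> R) (a : R) (m : nat) :
  comparable_power f a m ->
  exists c C eta, 0 < c /\ 0 <= C /\ 0 < eta /\ forall t, 0 < t < eta ->
    c * t ^ m <= Rabs (f (a + t)) <= C * t ^ m.
Proof.
  intros (c & C & Hc & [eta Heta]).
  assert (H : forall t, 0 < t < eta -> c * t ^ m <= Rabs (f (a + t)) <= C * t ^ m).
  { intros t Ht. specialize (Heta (a + t)).
    replace (a + t - a) with t in Heta by ring. rewrite (Rabs_pos_eq t) in Heta by lra.
    apply Heta. change (Rabs (a + t - a) < eta).
    replace (a + t - a) with t by ring. rewrite Rabs_pos_eq; lra. }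
  exists c, (Rmax C 0), eta. split; [exact Hc|]. split; [apply Rmax_r|]. split; [apply eta|].
  intros t Ht. destruct (H t Ht) as [H1 H2]. split; [exact H1|].
  apply Rle_trans with (1 := H2). apply Rmult_le_compat_r; [apply pow_le; lra|apply Rmax_l].
Qed.

(** A first nonvanishing derivative of order [k] makes [f (a + t)] of exact order
    [t ^ k]; this is compatible with [t ^ m] only for [k = m]. *)
Lemma vanishing_order_comparable (f : R -> R) (a : R) (m : nat) :
  0 < a -> (forall n x, 0 < x -> ex_derive_n f n x) ->
  comparable_power f a m -> vanishing_order f a m.
Proof.
  intros Ha Hf Hcmp.
  destruct (comparable_power_right f a m Hcmp) as (c & C & e1 & Hc & HC & He1 & H).
  assert (Hz : forall k, (k <= m)%nat -> forall i, (i < k)%nat -> Derive_n f i a = 0).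
  { induction k as [|k IH]; intros Hk i Hi; [lia|].
    destruct (Nat.eq_dec i k) as [->|Hne]; [|apply IH; lia].
    destruct (taylor_leading_term f a k Ha Hf (IH ltac:(lia))) as (K & e2 & HK & He2 & HT).
    set (d := Derive_n f k a / INR (fact k)) in *.
    assert (Hd : Rabs d <= 0).
    { assert (He : 0 < Rmin 1 (Rmin e1 e2)) by (repeat apply Rmin_glb_lt; lra).
      apply le_0_of_le_linear with (K := K + C) (1 := He). intros t Ht.
      assert (t < 1 /\ t < e1 /\ t < e2) as (Ht1 & Ht2 & Ht3).
      { pose proof (Rmin_l 1 (Rmin e1 e2)). pose proof (Rmin_r 1 (Rmin e1 e2)).
        pose proof (Rmin_l e1 e2). pose proof (Rmin_r e1 e2). lra. }
      specialize (HT t ltac:(lra)). destruct (H t ltac:(lra)) as [_ H2].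
      assert (Hp : 0 < t ^ k) by (apply pow_lt; lra).
      assert (Hpm : t ^ m <= t ^ S k).
      { replace m with (S k + (m - S k))%nat by lia. rewrite pow_add.
        assert (t ^ (m - S k) <= 1).
        { rewrite <- (pow1 (m - S k)). apply pow_incr. lra. }
        assert (0 < t ^ S k) by (apply pow_lt; lra). nra. }
      apply Rmult_le_reg_r with (t ^ k); [exact Hp|].
      rewrite <- (Rabs_pos_eq (t ^ k)) at 1 by lra. rewrite <- Rabs_mult.
      pose proof (Rabs_triang_inv (d * t ^ k) (f (a + t))) as Htr.
      rewrite Rabs_minus_sym in Htr.
      replace ((K + C) * t * t ^ k) with (K * t ^ S k + C * t ^ S k) by (simpl; ring).
      assert (C * t ^ m <= C * t ^ S k) by (apply Rmult_le_compat_l; assumption).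
      lra. }
    assert (Hd0 : d = 0).
    { pose proof (Rabs_pos d). destruct (Req_dec d 0) as [E|E]; [exact E|].
      apply Rabs_pos_lt in E. lra. }
    unfold d in Hd0. pose proof (INR_fact_neq_0 k).
    replace (Derive_n f k a) with (Derive_n f k a / INR (fact k) * INR (fact k)) by (field; assumption).
    rewrite Hd0. ring. }
  split; [intros k Hk; apply (Hz m (le_n _) k Hk)|].
  intros E.
  destruct (taylor_leading_term f a m Ha Hf (Hz m (le_n _))) as (K & e2 & HK & He2 & HT).
  assert (c <= 0); [|lra].
  assert (He : 0 < Rmin e1 e2) by (apply Rmin_glb_lt; lra).
  apply le_0_of_le_linear with (K := K) (1 := He). intros t Ht.
  pose proof (Rmin_l e1 e2). pose proof (Rmin_r e1 e2).
  specialize (HT t ltac:(lra)). destruct (H t ltac:(lra)) as [Hlo _].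
  rewrite E in HT. unfold Rdiv in HT. rewrite !Rmult_0_l, Rminus_0_r in HT.
  assert (Hp : 0 < t ^ m) by (apply pow_lt; lra).
  apply Rmult_le_reg_r with (t ^ m); [exact Hp|].
  replace (K * t * t ^ m) with (K * t ^ S m) by (simpl; ring). lra.
Qed.

(** * The logarithmic derivative of a product *)

(** With [u = |s| * sum |b|], the product is within [u ^ 2] of its first-order
    expansion as long as [u <= 1]. *)
Lemma prodn_expansion (b : nat -> R) (s : R) (n : nat) :
  Rabs s * sumn (fun k => Rabs (b k)) n <= 1 ->
  Rabs (prodn (fun k => 1 - s * b k) n - 1 + s * sumn b n)
  <= (Rabs s * sumn (fun k => Rabs (b k)) n) ^ 2.
Proof.
  induction n as [|n IH]; intros H.
  - simpl. replace (1 - 1 + s * 0) with 0 by ring. rewrite Rabs_R0. nra.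
  - simpl sumn in *. simpl prodn.
    set (p := prodn (fun k => 1 - s * b k) n) in *.
    set (T := sumn b n) in *. set (B := sumn (fun k => Rabs (b k)) n) in *.
    assert (HB : 0 <= B).
    { unfold B. clear. induction n as [|n IH]; simpl; [lra|]. pose proof (Rabs_pos (b n)). lra. }
    pose proof (Rabs_pos s) as Hs. pose proof (Rabs_pos (b n)) as Hbn.
    assert (Hu : 0 <= Rabs s * B) by (apply Rmult_le_pos; assumption).
    assert (Hv : 0 <= Rabs s * Rabs (b n)) by (apply Rmult_le_pos; assumption).
    specialize (IH ltac:(lra)).
    assert (HT : Rabs T <= B).
    { unfold T, B. clear. induction n as [|n IH]; simpl; [rewrite Rabs_R0; lra|].
      apply Rle_trans with (1 := Rabs_triang _ _). lra. }
    assert (Hp : Rabs (1 - p) <= 2 * (Rabs s * B)).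
    { replace (1 - p) with (- (p - 1 + s * T) + s * T) by ring.
      apply Rle_trans with (1 := Rabs_triang _ _). rewrite Rabs_Ropp, (Rabs_mult s T). nra. }
    replace (p * (1 - s * b n) - 1 + s * (T + b n))
      with ((p - 1 + s * T) + s * b n * (1 - p)) by ring.
    apply Rle_trans with (1 := Rabs_triang _ _).
    rewrite (Rabs_mult (s * b n)), (Rabs_mult s (b n)).
    set (u := Rabs s * B) in *. set (v := Rabs s * Rabs (b n)) in *.
    assert (v * Rabs (1 - p) <= v * (2 * u)) by (apply Rmult_le_compat_l; assumption).
    replace (Rabs s * (B + Rabs (b n))) with (u + v) by (unfold u, v; ring). nra.
Qed.

Lemma ex_series_reciprocal (h : nat -> R) (x : R) :
  (forall j, INR j + 1 <= h j) -> ex_series (fun n => Rabs (/ (h n ^ 2 - x ^ 2))).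
Proof.
  intros Hh. destruct (INR_unbounded (2 * x ^ 2)) as [N HN].
  apply (ex_series_incr_n _ N).
  apply ex_series_le_Rabs with (fun k => 2 * / (INR (N + k) + 1) ^ 2).
  - intros k. rewrite Rabs_Rabsolu.
    specialize (Hh (N + k)%nat). rewrite plus_INR in *.
    pose proof (pos_INR k). pose proof (pos_INR N). pose proof (pow2_ge_0 x).
    set (q := INR N + INR k + 1) in *.
    assert (Hq1 : 2 * x ^ 2 <= q ^ 2) by (unfold q; nra).
    assert (Hq2 : q ^ 2 <= h (N + k)%nat ^ 2) by (apply pow_incr; unfold q in *; lra).
    assert (Hq3 : 0 < q ^ 2) by (unfold q; nra).
    rewrite Rabs_pos_eq by (apply Rlt_le, Rinv_0_lt_compat; lra).
    replace (2 * / q ^ 2) with (/ (q ^ 2 / 2)) by (field; unfold q; lra).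
    apply Rinv_le_contravar; lra.
  - apply (ex_series_incr_n (fun k => 2 * / (INR k + 1) ^ 2) N).
    apply ex_series_scaled_inv_sq.
Qed.

Lemma is_derive_quadratic (F : R -> R) (x D K : R) (d : posreal) :
  (forall y, Rabs (y - x) < d -> Rabs (F y - F x - D * (y - x)) <= K * (y - x) ^ 2) ->
  is_derive F x D.
Proof.
  intros H. apply is_derive_Reals. intros eps He.
  assert (Hd : 0 < Rmin d (eps / (Rabs K + 1))).
  { apply Rmin_glb_lt; [apply d|]. pose proof (Rabs_pos K). apply Rdiv_lt_0_compat; lra. }
  exists (mkposreal _ Hd). intros t Ht Hlt. simpl in Hlt.
  pose proof (Rmin_l d (eps / (Rabs K + 1))). pose proof (Rmin_r d (eps / (Rabs K + 1))).
  specialize (H (x + t)). replace (x + t - x) with t in H by ring.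
  specialize (H ltac:(lra)).
  replace ((F (x + t) - F x) / t - D) with ((F (x + t) - F x - D * t) / t) by (field; exact Ht).
  pose proof (Rabs_pos_lt t Ht) as Ht0. pose proof (Rabs_pos K).
  unfold Rdiv. rewrite Rabs_mult, Rabs_inv.
  apply Rmult_lt_reg_r with (Rabs t); [exact Ht0|].
  rewrite Rmult_assoc, Rinv_l, Rmult_1_r by lra.
  apply Rle_lt_trans with (1 := H). rewrite <- (pow2_abs t).
  assert (Hk : (Rabs K + 1) * Rabs t < eps).
  { apply Rlt_le_trans with ((Rabs K + 1) * (eps / (Rabs K + 1))).
    - apply Rmult_lt_compat_l; lra.
    - right. field. lra. }
  pose proof (Rle_abs K).
  assert (K * Rabs t <= (Rabs K + 1) * Rabs t) by (apply Rmult_le_compat_r; lra).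
  nra.
Qed.

(** Passing from [x] to [y] multiplies the factor with zero [h n] by
    [1 - (y ^ 2 - x ^ 2) / (h n ^ 2 - x ^ 2)]. Expanding the product of these to first
    order replaces the exchange of limit and derivative. *)
Lemma product_is_derive (F : R -> R) (h : nat -> R) (x : R) :
  (forall j, INR j + 1 <= h j) ->
  (forall x, is_lim_seq (prodn (fun j => 1 - x ^ 2 / h j ^ 2)) (F x)) ->
  (forall n, x <> h n /\ x <> - h n) ->
  ex_series (fun n => 2 * x / (x ^ 2 - h n ^ 2)) /\
  is_derive F x (F x * Series (fun n => 2 * x / (x ^ 2 - h n ^ 2))).
Proof.
  intros Hh HF Hx.
  assert (Hh0 : forall j, 0 < h j) by (intros j; specialize (Hh j); pose proof (pos_INR j); lra).
  assert (Hne : forall n, h n ^ 2 - x ^ 2 <> 0).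
  { intros n E. destruct (Hx n) as [Hx1 Hx2].
    assert (E2 : (x - h n) * (x + h n) = 0) by lra.
    apply Rmult_integral in E2 as [E2|E2]; [apply Hx1|apply Hx2]; lra. }
  set (b := fun n => / (h n ^ 2 - x ^ 2)).
  assert (Hab : ex_series (fun n => Rabs (b n))) by (apply ex_series_reciprocal, Hh).
  assert (Hb : ex_series b) by apply ex_series_Rabs, Hab.
  assert (Eb : forall n, - (2 * x) * b n = 2 * x / (x ^ 2 - h n ^ 2)).
  { intros n. specialize (Hne n). unfold b. field. lra. }
  split.
  { apply ex_series_ext with (1 := Eb).
    apply (ex_series_scal_l (V := R_NormedModule) (- (2 * x))), Hb. }
  rewrite <- (Series_ext _ _ Eb), Series_scal_l.
  set (Sb := Series b). set (B := Series (fun n => Rabs (b n))).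
  assert (HB : forall n, 0 <= sumn (fun k => Rabs (b k)) n <= B).
  { intros n. split.
    - apply (sumn_le (fun k => Rabs (b k)) 0 n); [intros; apply Rabs_pos|lia].
    - apply sumn_le_Series; [intros; apply Rabs_pos|exact Hab]. }
  assert (HB0 : 0 <= B) by (specialize (HB 0%nat); lra).
  assert (Hexp : forall y, Rabs (y ^ 2 - x ^ 2) * B <= 1 ->
    Rabs (F y - F x + (y ^ 2 - x ^ 2) * F x * Sb)
    <= Rabs (F x) * ((y ^ 2 - x ^ 2) * B) ^ 2).
  { intros y Hy. set (s := y ^ 2 - x ^ 2) in *.
    set (P := prodn (fun j => 1 - x ^ 2 / h j ^ 2)).
    pose proof (is_lim_seq_abs _ _ (HF x)) as HP. fold P in HP.
    apply (is_lim_seq_le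
      (fun n => Rabs (prodn (fun j => 1 - y ^ 2 / h j ^ 2) n - P n + s * P n * sumn b n))
      (fun n => Rabs (P n) * (s * B) ^ 2)
      (Rabs (F y - F x + s * F x * Sb)) (Rabs (F x) * (s * B) ^ 2)).
    - intros n.
      assert (E : prodn (fun j => 1 - y ^ 2 / h j ^ 2) n = P n * prodn (fun k => 1 - s * b k) n).
      { unfold P. induction n as [|n IH]; cbn [prodn]; [ring|].
        rewrite IH. specialize (Hne n). specialize (Hh0 n).
        replace (1 - s * b n) with ((h n ^ 2 - y ^ 2) / (h n ^ 2 - x ^ 2))
          by (unfold s, b; field; exact Hne).
        replace (1 - y ^ 2 / h n ^ 2)
          with ((1 - x ^ 2 / h n ^ 2)
                * ((h n ^ 2 - y ^ 2) / (h n ^ 2 - x ^ 2))) by (field; split; lra).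
        ring. }
      rewrite E.
      replace (P n * prodn (fun k => 1 - s * b k) n - P n + s * P n * sumn b n)
        with (P n * (prodn (fun k => 1 - s * b k) n - 1 + s * sumn b n)) by ring.
      rewrite Rabs_mult. apply Rmult_le_compat_l; [apply Rabs_pos|].
      specialize (HB n). pose proof (Rabs_pos s).
      apply Rle_trans with (1 := prodn_expansion b s n ltac:(nra)).
      rewrite !Rpow_mult_distr, pow2_abs. apply Rmult_le_compat_l; [apply pow2_ge_0|].
      apply pow_incr. exact HB.
    - apply (is_lim_seq_abs _ (F y - F x + s * F x * Sb)).
      apply is_lim_seq_plus'.
      + apply is_lim_seq_minus'; apply HF.
      + apply is_lim_seq_mult'; [|apply is_lim_seq_sumn, Hb].
        apply is_lim_seq_mult'; [apply is_lim_seq_const|apply HF].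
    - apply is_lim_seq_mult'; [exact HP|apply is_lim_seq_const]. }
  set (M := 2 * Rabs x + 1).
  assert (HM : 1 <= M) by (unfold M; pose proof (Rabs_pos x); lra).
  assert (Hd : 0 < Rmin 1 (/ (M * (B + 1)))).
  { apply Rmin_glb_lt; [lra|]. apply Rinv_0_lt_compat. nra. }
  apply is_derive_quadratic with
    (Rabs (F x) * (M * B) ^ 2 + Rabs (F x * Sb)) (mkposreal _ Hd).
  intros y Hy. simpl in Hy.
  pose proof (Rmin_l 1 (/ (M * (B + 1)))) as Hm1.
  pose proof (Rmin_r 1 (/ (M * (B + 1)))) as Hm2.
  set (t := y - x) in *.
  assert (Hyx : Rabs (y + x) <= M).
  { replace (y + x) with (t + 2 * x) by (unfold t; ring).
    apply Rle_trans with (1 := Rabs_triang _ _).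
    rewrite Rabs_mult, (Rabs_pos_eq 2) by lra. unfold M. lra. }
  assert (Es : y ^ 2 - x ^ 2 = t * (y + x)) by (unfold t; ring).
  pose proof (Rabs_pos t) as Ht0. pose proof (Rabs_pos (y + x)) as Hyx0.
  assert (Hsmall : Rabs (y ^ 2 - x ^ 2) * B <= 1).
  { rewrite Es, Rabs_mult.
    apply Rle_trans with (Rabs t * (M * (B + 1))).
    - rewrite Rmult_assoc. apply Rmult_le_compat_l; [exact Ht0|].
      apply Rmult_le_compat; lra.
    - apply Rle_trans with (/ (M * (B + 1)) * (M * (B + 1))).
      + apply Rmult_le_compat_r; [nra|lra].
      + right. field. nra. }
  specialize (Hexp y Hsmall).
  replace (F y - F x - F x * (- (2 * x) * Sb) * t)
    with ((F y - F x + (y ^ 2 - x ^ 2) * F x * Sb) + - (F x * Sb * t ^ 2))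
    by (rewrite Es; unfold t; ring).
  apply Rle_trans with (1 := Rabs_triang _ _).
  rewrite Rabs_Ropp, (Rabs_mult (F x * Sb)), (Rabs_pos_eq (t ^ 2)) by apply pow2_ge_0.
  rewrite Rmult_plus_distr_r. apply Rplus_le_compat_r.
  apply Rle_trans with (1 := Hexp). rewrite Rmult_assoc.
  apply Rmult_le_compat_l; [apply Rabs_pos|].
  rewrite Es, !Rpow_mult_distr.
  assert ((y + x) ^ 2 <= M ^ 2).
  { rewrite <- pow2_abs. apply pow_incr. lra. }
  pose proof (pow2_ge_0 t). pose proof (pow2_ge_0 B).
  replace (t ^ 2 * (y + x) ^ 2 * B ^ 2) with ((y + x) ^ 2 * (B ^ 2 * t ^ 2)) by ring.
  rewrite Rmult_assoc. apply Rmult_le_compat_r; [apply Rmult_le_pos; assumption|assumption].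
Qed.

(** * Uniqueness of the enumeration of the zeros *)

Lemma vanishing_order_unique (f : R -> R) (x : R) (m k : nat) :
  vanishing_order f x m -> vanishing_order f x k -> m = k.
Proof.
  intros [Hm1 Hm2] [Hk1 Hk2].
  destruct (Nat.lt_trichotomy m k) as [H|[H|H]]; [|exact H|].
  - contradiction (Hm2 (Hk1 m H)).
  - contradiction (Hk2 (Hm1 k H)).
Qed.

Lemma nondecreasing_le (h : nat -> R) (m n : nat) :
  (forall n, h n <= h (S n)) -> (m <= n)%nat -> h m <= h n.
Proof.
  intros Hh H. induction H as [|n H IH]; [lra|]. specialize (Hh n). lra.
Qed.

(** If the sequences first differ at [n] with [h n < h' n], then [h'] takes the value
    [h n] only at indices below [n], where it agrees with [h]; so [h] takes it more
    often, contrary to the common multiplicity. *)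
Lemma positive_zeros_not_lt (f : R -> R) (h h' : nat -> R) (n : nat) :
  positive_zeros f h -> positive_zeros f h' ->
  (forall k, (k < n)%nat -> h k = h' k) -> h' n <= h n.
Proof.
  intros (Hp & _ & Hm) (_ & Hi' & Hm') Heq. apply Rnot_lt_le. intros Hlt.
  destruct (Hm (h n) (Hp n)) as (m & Hv & l & _ & Hlen & Hl).
  destruct (Hm' (h n) (Hp n)) as (m' & Hv' & l' & Hnd' & Hlen' & Hl').
  rewrite (vanishing_order_unique _ _ _ _ Hv' Hv) in Hlen'.
  assert (Hsmall : forall k, In k l' -> (k < n)%nat).
  { intros k Hk. apply Hl' in Hk. destruct (le_lt_dec n k) as [H|H]; [|exact H].
    pose proof (nondecreasing_le h' n k Hi' H). lra. }
  assert (H : (length (n :: l') <= length l)%nat).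
  { apply NoDup_incl_length.
    - constructor; [|exact Hnd']. intros Hn. specialize (Hsmall n Hn). lia.
    - intros k [<-|Hk]; apply Hl; [reflexivity|].
      rewrite Heq by (apply Hsmall, Hk). apply Hl', Hk. }
  simpl in H. lia.
Qed.

Lemma positive_zeros_unique (f : R -> R) (h h' : nat -> R) :
  positive_zeros f h -> positive_zeros f h' -> forall n, h n = h' n.
Proof.
  intros H H' n. induction n as [n IH] using lt_wf_ind.
  apply Rle_antisym.
  - apply positive_zeros_not_lt with f; try assumption. intros k Hk. symmetry. apply IH, Hk.
  - apply positive_zeros_not_lt with f; assumption.
Qed.

(** * Smoothness of the Struve function *)

(** Differentiability [n] times on the positive half-line with explicit derivatives,
    which makes closure under products an easy induction. *)
Fixpoint smooth_upto (n : nat) (f : R -> R) : Prop :=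
  match n with
  | O => True
  | S k => exists f', (forall x, 0 < x -> is_derive f x (f' x)) /\ smooth_upto k f'
  end.

Lemma smooth_upto_pred (n : nat) (f : R -> R) : smooth_upto (S n) f -> smooth_upto n f.
Proof.
  revert f. induction n as [|n IH]; intros f; [simpl; auto|].
  intros (f' & Hd & Hf). exists f'. split; [exact Hd|]. apply IH, Hf.
Qed.

Lemma smooth_upto_plus (n : nat) (f g : R -> R) :
  smooth_upto n f -> smooth_upto n g -> smooth_upto n (fun x => f x + g x).
Proof.
  revert f g. induction n as [|n IH]; intros f g; [simpl; auto|].
  intros (f' & Hdf & Hf) (g' & Hdg & Hg). exists (fun x => f' x + g' x). split.
  - intros x Hx. apply (is_derive_plus (V := R_NormedModule)); auto.
  - apply IH; assumption.
Qed.

Lemma smooth_upto_mult (n : nat) (f g : R -> R) :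
  smooth_upto n f -> smooth_upto n g -> smooth_upto n (fun x => f x * g x).
Proof.
  revert f g. induction n as [|n IH]; intros f g Hf Hg; [exact I|].
  pose proof (smooth_upto_pred _ _ Hf) as Hf0. pose proof (smooth_upto_pred _ _ Hg) as Hg0.
  destruct Hf as (f' & Hdf & Hf). destruct Hg as (g' & Hdg & Hg).
  exists (fun x => f' x * g x + f x * g' x). split.
  - intros x Hx. apply (is_derive_mult f g); auto. intros u v. apply Rmult_comm.
  - apply smooth_upto_plus; apply IH; assumption.
Qed.

Lemma smooth_upto_const (n : nat) (c : R) : smooth_upto n (fun _ => c).
Proof.
  revert c. induction n as [|n IH]; intros c; [exact I|].
  exists (fun _ => 0). split; [|apply IH].
  intros x _. apply (is_derive_const (V := R_NormedModule)).
Qed.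

Lemma smooth_upto_half (n : nat) : smooth_upto n (fun x => x / 2).
Proof.
  destruct n as [|n]; [exact I|]. exists (fun _ => 1 / 2). split; [|apply smooth_upto_const].
  intros x _. auto_derive; [exact I|]. field.
Qed.

Lemma smooth_upto_Rpower (n : nat) (r : R) : smooth_upto n (fun x => Rpower (x / 2) r).
Proof.
  revert r. induction n as [|n IH]; intros r; [exact I|].
  exists (fun x => r / 2 * Rpower (x / 2) (r - 1)). split.
  - intros x Hx. replace (Rpower (x / 2) (r - 1)) with (Rpower (x / 2) r / (x / 2)).
    + unfold Rpower, Rdiv. auto_derive; [lra|]. field. lra.
    + unfold Rminus. rewrite Rpower_plus, Rpower_Ropp, Rpower_1 by lra. reflexivity.
  - apply smooth_upto_mult; [apply smooth_upto_const|apply IH].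
Qed.

Lemma is_derive_PSeries_half_sq (c : nat -> R) (x : R) :
  CV_radius c = p_infty ->
  is_derive (fun x => PSeries c ((x / 2) ^ 2)) x (PSeries (PS_derive c) ((x / 2) ^ 2) * (x / 2)).
Proof.
  intros Hc.
  evar_last.
  - apply (is_derive_comp (PSeries c) (fun x => (x / 2) ^ 2)).
    + apply is_derive_PSeries. rewrite Hc. exact I.
    + auto_derive; [exact I|reflexivity].
  - unfold scal; simpl; unfold mult; simpl. field.
Qed.

(** The induction works for all series of infinite radius at once, because the
    derivative brings in another one. *)
Lemma smooth_upto_PSeries (n : nat) (c : nat -> R) :
  CV_radius c = p_infty -> smooth_upto n (fun x => PSeries c ((x / 2) ^ 2)).
Proof.
  revert c. induction n as [|n IH]; intros c Hc; [exact I|].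
  exists (fun x => PSeries (PS_derive c) ((x / 2) ^ 2) * (x / 2)). split.
  - intros x _. apply is_derive_PSeries_half_sq, Hc.
  - apply smooth_upto_mult; [|apply smooth_upto_half].
    apply IH. rewrite CV_radius_derive. exact Hc.
Qed.

Lemma smooth_upto_ex_derive_n (n : nat) (f : R -> R) (x : R) :
  smooth_upto n f -> 0 < x -> ex_derive_n f n x.
Proof.
  revert f x. induction n as [|n IH]; intros f x Hf Hx; [exact I|].
  destruct Hf as (f' & Hd & Hf').
  assert (E : forall k y, 0 < y -> Derive_n f (S k) y = Derive_n f' k y).
  { induction k as [|k IHk]; intros y Hy.
    - apply is_derive_unique, Hd, Hy.
    - change (Derive (Derive_n f (S k)) y = Derive (Derive_n f' k) y).
      apply Derive_ext_loc. exists (mkposreal y Hy). intros t Ht. apply IHk.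
      change (Rabs (t - y) < y) in Ht. apply Rabs_lt_between in Ht. lra. }
  destruct n as [|n].
  - exists (f' x). apply Hd, Hx.
  - specialize (IH f' x Hf' Hx). simpl in IH |- *.
    apply ex_derive_ext_loc with (2 := IH).
    exists (mkposreal x Hx). intros t Ht. symmetry. apply E.
    change (Rabs (t - x) < x) in Ht. apply Rabs_lt_between in Ht. lra.
Qed.

Definition struve_coef (nu : R) (n : nat) : R :=
  (-1) ^ n * rGamma (INR n + 3 / 2) * rGamma (INR n + nu + 3 / 2).

Lemma struve_series_PSeries (nu x : R) :
  struve_series nu x = PSeries (struve_coef nu) ((x / 2) ^ 2).
Proof.
  apply Series_ext. intros n. unfold struve_coef. rewrite <- pow_mult. ring.
Qed.

Lemma struve_coef_neq_0 (nu : R) (n : nat) : - 1 / 2 <= nu -> struve_coef nu n <> 0.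
Proof.
  intros Hnu. pose proof (pos_INR n). unfold struve_coef.
  apply Rmult_integral_contrapositive_currified;
    [apply Rmult_integral_contrapositive_currified|].
  - apply pow_nonzero. lra.
  - apply rGamma_neq_0. lra.
  - apply rGamma_neq_0. lra.
Qed.

Lemma rGamma_S (y : R) (n : nat) :
  0 <= INR n + y -> rGamma (INR n + y) = (INR n + y) * rGamma (INR (S n) + y).
Proof.
  intros H. rewrite rGamma_rec by exact H. do 2 f_equal. rewrite S_INR. ring.
Qed.

Lemma struve_coef_S (nu : R) (n : nat) :
  - 1 / 2 <= nu ->
  struve_coef nu n = - ((INR n + 3 / 2) * (INR n + nu + 3 / 2)) * struve_coef nu (S n).
Proof.
  intros Hnu. pose proof (pos_INR n). unfold struve_coef.
  rewrite (rGamma_S (3 / 2)) by lra.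
  replace (INR n + nu + 3 / 2) with (INR n + (nu + 3 / 2)) by ring.
  rewrite (rGamma_S (nu + 3 / 2)) by lra.
  replace (INR (S n) + nu + 3 / 2) with (INR (S n) + (nu + 3 / 2)) by ring.
  simpl pow. ring.
Qed.

Lemma struve_coef_radius (nu : R) : - 1 / 2 <= nu -> CV_radius (struve_coef nu) = p_infty.
Proof.
  intros Hnu. apply CV_radius_infinite_DAlembert.
  - intros n. apply struve_coef_neq_0, Hnu.
  - apply is_lim_seq_ext with (fun n => / (INR n + 3 / 2) * / (INR n + (nu + 3 / 2))).
    + intros n. pose proof (pos_INR n). pose proof (struve_coef_neq_0 nu (S n) Hnu).
      rewrite (struve_coef_S nu n Hnu).
      replace (struve_coef nu (S n)
               / (- ((INR n + 3 / 2) * (INR n + nu + 3 / 2)) * struve_coef nu (S n)))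
        with (- (/ (INR n + 3 / 2) * / (INR n + (nu + 3 / 2)))) by (field; lra).
      rewrite Rabs_Ropp, Rabs_pos_eq; [reflexivity|].
      apply Rmult_le_pos; apply Rlt_le, Rinv_0_lt_compat; lra.
    + replace (Finite 0) with (Finite (0 * 0)) by (f_equal; ring).
      apply is_lim_seq_mult'; apply is_lim_seq_inv_infty, is_lim_seq_INR_plus.
Qed.

Lemma ex_derive_n_struve (nu : R) (n : nat) (x : R) :
  - 1 / 2 <= nu -> 0 < x -> ex_derive_n (struve nu) n x.
Proof.
  intros Hnu Hx.
  apply ex_derive_n_ext with
    (fun x => Rpower (x / 2) (nu + 1) * PSeries (struve_coef nu) ((x / 2) ^ 2)).
  { intros t. unfold struve. rewrite struve_series_PSeries. reflexivity. }
  apply smooth_upto_ex_derive_n; [|exact Hx].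
  apply smooth_upto_mult; [apply smooth_upto_Rpower|].
  apply smooth_upto_PSeries, struve_coef_radius, Hnu.
Qed.

(** * The normalized Struve function *)

Lemma hyp_term_bound (lam x : R) (m : nat) :
  0 <= lam -> Rabs (hyp_term lam x m) <= sinh_term x m.
Proof.
  intros Hl. induction m as [|m IH].
  - simpl. rewrite Rabs_R1. unfold sinh_term. simpl. lra.
  - change (hyp_term lam x (S m)) with (hyp_term lam x m
      * (- x ^ 2 / ((2 * INR m + 3) * (2 * INR m + 2)) * ((INR m + 1) / (lam + INR m + 1)))).
    pose proof (pos_INR m) as Hm. pose proof (pow2_ge_0 x) as Hx.
    rewrite sinh_term_S, Rabs_mult. apply Rmult_le_compat; try apply Rabs_pos; [exact IH|].
    replace (- x ^ 2 / ((2 * INR m + 3) * (2 * INR m + 2)) * ((INR m + 1) / (lam + INR m + 1)))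
      with (- (x ^ 2 / ((2 * INR m + 3) * (2 * INR m + 2)) * ((INR m + 1) / (lam + INR m + 1))))
      by (field; lra).
    assert (HA : 0 <= x ^ 2 / ((2 * INR m + 3) * (2 * INR m + 2)))
      by (apply Rdiv_le_0_compat; nra).
    assert (HB : 0 <= (INR m + 1) / (lam + INR m + 1) <= 1).
    { split; [apply Rdiv_le_0_compat; lra|]. apply Rle_div_l; lra. }
    rewrite Rabs_Ropp, Rabs_pos_eq by (apply Rmult_le_pos; lra).
    rewrite <- (Rmult_1_r (x ^ 2 / _)) at 2. apply Rmult_le_compat_l; lra.
Qed.

(** The value at [n = 0] is where [Gamma (3 / 2) = sqrt PI / 2] enters. *)
Lemma calH_term_hyp (nu x : R) (n : nat) :
  - 1 / 2 <= nu -> sqrt PI / 2 * calH_term nu x n = hyp_term (nu + 1 / 2) x n.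
Proof.
  intros Hnu.
  assert (E : calH_term nu x n
    = Gamma (nu + 3 / 2) * (struve_coef nu n * (x ^ 2 / 4) ^ n)).
  { unfold calH_term, struve_coef. rewrite !pow_mult.
    replace (2 ^ 2) with 4 by ring.
    replace ((x ^ 2 / 4) ^ n) with ((x ^ 2) ^ n * / 4 ^ n)
      by (rewrite <- pow_inv, <- Rpow_mult_distr; reflexivity).
    generalize (rGamma (INR n + 3 / 2)) (rGamma (INR n + nu + 3 / 2)).
    intros r s. unfold Rdiv. ring. }
  rewrite E. clear E. induction n as [|n IH].
  - unfold struve_coef. simpl.
    rewrite !Rplus_0_l, Gamma_eq_int, !rGamma_eq_int by lra.
    replace (3 / 2) with (1 / 2 + 1) by field.
    rewrite (Gamma_int_rec (1 / 2)), Gamma_int_half by lra.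
    pose proof (Gamma_int_pos (nu + (1 / 2 + 1)) ltac:(lra)).
    pose proof (sqrt_lt_R0 PI PI_RGT_0). field. lra.
  - change (hyp_term (nu + 1 / 2) x (S n)) with (hyp_term (nu + 1 / 2) x n
      * (- x ^ 2 / ((2 * INR n + 3) * (2 * INR n + 2))
         * ((INR n + 1) / (nu + 1 / 2 + INR n + 1)))).
    rewrite <- IH, (struve_coef_S nu n Hnu). pose proof (pos_INR n).
    cbn [pow]. field. lra.
Qed.

Lemma calH_hyp (nu x : R) : - 1 / 2 <= nu -> calH nu x = hyp (nu + 1 / 2) x.
Proof.
  intros Hnu. unfold calH, hyp. rewrite <- Series_scal_l.
  apply Series_ext. intros n. apply calH_term_hyp, Hnu.
Qed.

Lemma ex_series_calH_term (nu x : R) : - 1 / 2 <= nu -> ex_series (calH_term nu x).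
Proof.
  intros Hnu. pose proof (sqrt_lt_R0 PI PI_RGT_0).
  assert (E : forall n, 2 / sqrt PI * hyp_term (nu + 1 / 2) x n = calH_term nu x n).
  { intros n. rewrite <- (calH_term_hyp nu x n Hnu). field. lra. }
  apply ex_series_ext with (1 := E).
  apply (ex_series_scal_l (V := R_NormedModule) (2 / sqrt PI)).
  apply ex_series_le_Rabs with (sinh_term x); [|apply ex_series_sinh_term].
  intros m. apply hyp_term_bound. lra.
Qed.

Lemma calH_struve_series (nu x : R) :
  calH nu x = sqrt PI / 2 * Gamma (nu + 3 / 2) * struve_series nu x.
Proof.
  unfold calH, struve_series. rewrite Rmult_assoc, <- (Series_scal_l (Gamma _)).
  f_equal. apply Series_ext. intros n. unfold calH_term, Rdiv.
  rewrite Rpow_mult_distr, pow_inv. ring.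
Qed.

Lemma hyp_even (lam x : R) : hyp lam x = hyp lam (Rabs x).
Proof.
  apply Series_ext. intros n. induction n as [|n IH]; cbn [hyp_term]; [reflexivity|].
  rewrite IH, pow2_abs. reflexivity.
Qed.

Lemma hyp_le_1_pos (lam x : R) : 0 <= lam <= 1 -> 0 < x -> hyp lam x <= 1.
Proof.
  intros Hlam Hx. destruct (interior_parameters lam Hlam) as (lamn & Hn & Hl).
  apply Rle_trans with (1 := Rle_abs _).
  apply is_lim_seq_Rabs_le with (1 := approx_lim lamn lam x (proj1 Hlam) Hn Hl).
  destruct (INR_unbounded x) as [N HN]. exists N. intros n Hge.
  apply approx_bound; [apply Hn|].
  apply le_INR in Hge. pose proof (scale_pos n) as HL.
  assert (H1 : 0 < x / scale n) by (apply Rdiv_lt_0_compat; assumption).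
  assert (H2 : x / scale n < 1).
  { apply Rlt_div_l; [exact HL|]. unfold scale. pose proof (pos_INR n). lra. }
  pose proof PI2_3_2. apply Rgt_not_eq, sin_gt_0; lra.
Qed.

(** For nonzero [x] the bound comes from the approximating polynomials; at 0 the
    product has all factors equal to 1. *)
Lemma hyp_le_1 (lam x : R) : 0 <= lam <= 1 -> hyp lam x <= 1.
Proof.
  intros Hlam. rewrite hyp_even. destruct (Rabs_pos x) as [Hx|<-].
  - apply hyp_le_1_pos; assumption.
  - destruct (hyp_factorization lam Hlam) as (h & _ & _ & HF).
    right. assert (H : is_lim_seq (fun _ => 1) (hyp lam 0)).
    { apply is_lim_seq_ext with (2 := HF 0). intros n.
      induction n as [|n IH]; cbn [prodn]; [reflexivity|]. rewrite IH. unfold Rdiv. ring. }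
    apply is_lim_seq_unique in H. rewrite Lim_seq_const in H. injection H as H. symmetry. exact H.
Qed.

Lemma calH_struve (nu x : R) :
  0 < x ->
  calH nu x = sqrt PI * Rpower 2 nu * Rpower x (- nu - 1) * Gamma (nu + 3 / 2) * struve nu x.
Proof.
  intros Hx. rewrite calH_struve_series. unfold struve.
  assert (E : Rpower 2 nu * Rpower x (- nu - 1) * Rpower (x / 2) (nu + 1) = / 2).
  { unfold Rpower. rewrite <- !exp_plus, ln_div by lra.
    replace (nu * ln 2 + (- nu - 1) * ln x + (nu + 1) * (ln x - ln 2)) with (- ln 2) by ring.
    rewrite exp_Ropp, exp_ln by lra. reflexivity. }
  replace (sqrt PI * Rpower 2 nu * Rpower x (- nu - 1) * Gamma (nu + 3 / 2)
           * (Rpower (x / 2) (nu + 1) * struve_series nu x))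
    with (sqrt PI * (Rpower 2 nu * Rpower x (- nu - 1) * Rpower (x / 2) (nu + 1))
          * Gamma (nu + 3 / 2) * struve_series nu x) by ring.
  rewrite E. field.
Qed.

Definition calH_factor (nu : R) : R := sqrt PI / 2 * Gamma (nu + 3 / 2).

Lemma calH_factor_pos (nu : R) : - 1 / 2 <= nu -> 0 < calH_factor nu.
Proof.
  intros Hnu. unfold calH_factor. rewrite Gamma_eq_int by lra.
  pose proof (sqrt_lt_R0 PI PI_RGT_0).
  apply Rmult_lt_0_compat; [lra|]. apply Gamma_int_pos. lra.
Qed.

Lemma comparable_power_ext (f g : R -> R) (a : R) (m : nat) :
  (forall x, f x = g x) -> comparable_power f a m -> comparable_power g a m.
Proof.
  intros E (c & C & Hc & H). exists c, C. split; [exact Hc|].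
  revert H. apply filter_imp. intros x. rewrite E. auto.
Qed.

Lemma In_index_list (h : nat -> R) (a : R) (J n : nat) :
  In n (index_list h a J) <-> (n < J)%nat /\ h n = a.
Proof.
  unfold index_list. rewrite filter_In, in_seq.
  destruct (Req_EM_T (h n) a) as [E|E]; split; intros [H1 H2]; split;
    try lia; try assumption; try reflexivity; try discriminate; contradiction.
Qed.

(** [struve nu] and [calH nu] differ by a smooth positive factor on the positive
    half-line, so they have the same multiplicities there. *)
Lemma positive_zeros_of_product (nu : R) (h : nat -> R) :
  - 1 / 2 <= nu ->
  (forall j, h j <= h (S j)) -> (forall j, INR j + 1 <= h j) ->
  (forall x, is_lim_seq (prodn (fun j => 1 - x ^ 2 / h j ^ 2)) (calH nu x)) ->
  positive_zeros (struve nu) h.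
Proof.
  intros Hnu Hinc Hh HF. pose proof (calH_factor_pos nu Hnu) as HK.
  split; [|split; [exact Hinc|]].
  { intros n. specialize (Hh n). pose proof (pos_INR n). lra. }
  intros a Ha.
  destruct (product_comparable_power (calH nu) h a Hh HF Ha) as (J & HJ & Hcmp).
  exists (length (index_list h a J)). split.
  - apply vanishing_order_comparable; [exact Ha| |].
    + intros n x Hx. apply ex_derive_n_struve; assumption.
    + apply comparable_power_ext with
        (fun x => Rpower (x / 2) (nu + 1) / calH_factor nu * calH nu x).
      { intros x. rewrite calH_struve_series. fold (calH_factor nu). unfold struve. field. lra. }
      apply (comparable_power_mult _ _ a 0); [|exact Hcmp].
      apply comparable_power_0.
      * apply derivable_continuous. unfold Rpower. auto_derive. lra.
      * apply Rgt_not_eq, Rdiv_lt_0_compat; [apply exp_pos|exact HK].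
  - exists (index_list h a J). split; [apply NoDup_filter, seq_NoDup|]. split; [reflexivity|].
    intros n. rewrite In_index_list. split; [tauto|]. intros E. split; [|exact E].
    destruct (le_lt_dec J n) as [H|H]; [|exact H]. contradiction (HJ n H E).
Qed.

(** * The quotient of consecutive Struve functions, and the theorem *)

(** The identity that [x ^ nu * H_{nu-1}] is the derivative of [x ^ nu * H_nu], read
    on the power series: the coefficients of index [nu - 1] are those of index [nu]
    multiplied by [n + nu + 1 / 2]. *)
Lemma struve_series_pred (nu x : R) :
  - 1 / 2 <= nu ->
  struve_series (nu - 1) x
  = x / 2 * (PSeries (PS_derive (struve_coef nu)) ((x / 2) ^ 2) * (x / 2))
    + (nu + 1 / 2) * struve_series nu x.
Proof.
  intros Hnu. rewrite !struve_series_PSeries. set (u := (x / 2) ^ 2).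
  set (c := struve_coef nu). set (d := PS_derive c).
  assert (Hc : ex_pseries c u).
  { apply CV_radius_inside. unfold c. rewrite struve_coef_radius by exact Hnu. exact I. }
  assert (Hd : ex_pseries d u).
  { apply CV_radius_inside. unfold d, c. rewrite CV_radius_derive, struve_coef_radius by exact Hnu. exact I. }
  assert (E : forall n, struve_coef (nu - 1) n = PS_plus (PS_incr_1 d) (PS_scal (nu + 1 / 2) c) n).
  { intros n. transitivity ((INR n + nu + 1 / 2) * c n).
    - unfold c, struve_coef. pose proof (pos_INR n).
      replace (INR n + (nu - 1) + 3 / 2) with (INR n + nu + 1 / 2) by field.
      rewrite (rGamma_rec (INR n + nu + 1 / 2)) by lra.
      replace (INR n + nu + 1 / 2 + 1) with (INR n + nu + 3 / 2) by field. ring.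
    - destruct n as [|n].
      + change ((0 + nu + 1 / 2) * c 0%nat = 0 + (nu + 1 / 2) * c 0%nat). ring.
      + change ((INR (S n) + nu + 1 / 2) * c (S n)
                = INR (S n) * c (S n) + (nu + 1 / 2) * c (S n)). ring. }
  rewrite (PSeries_ext _ _ u E), PSeries_plus, PSeries_incr_1, PSeries_scal.
  - unfold u at 1. field.
  - apply ex_pseries_incr_1, Hd.
  - apply ex_pseries_scal; [apply Rmult_comm|exact Hc].
Qed.

(** For positive [x] the powers of [x / 2] cancel up to the factor [2 / x]. *)
Lemma struve_quotient_series (nu x : R) :
  struve_quotient nu x = 2 / x * (struve_series (nu - 1) x / struve_series nu x).
Proof.
  unfold struve_quotient. destruct (Rlt_dec 0 x) as [Hx|Hx]; [|reflexivity].
  unfold struve. replace (nu - 1 + 1) with nu by ring.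
  rewrite Rpower_plus, Rpower_1 by lra.
  assert (0 < Rpower (x / 2) nu) by apply exp_pos.
  unfold Rdiv. rewrite !Rinv_mult, Rinv_inv.
  generalize (/ struve_series nu x). intros t. field. split; [apply Rgt_not_eq; assumption|lra].
Qed.

Lemma product_neq_0 (F : R -> R) (h : nat -> R) (a : R) :
  (forall j, INR j + 1 <= h j) ->
  (forall x, is_lim_seq (prodn (fun j => 1 - x ^ 2 / h j ^ 2)) (F x)) ->
  0 < a -> (forall n, a <> h n) -> F a <> 0.
Proof.
  intros Hh HF Ha Hne.
  destruct (product_comparable_power F h a Hh HF Ha) as (J & _ & c & C & Hc & Hloc).
  apply locally_singleton in Hloc.
  assert (E : index_list h a J = nil).
  { destruct (index_list h a J) as [|n l] eqn:E; [reflexivity|].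
    assert (H : In n (index_list h a J)) by (rewrite E; left; reflexivity).
    apply In_index_list in H as [_ H]. contradiction (Hne n). symmetry; exact H. }
  rewrite E in Hloc. simpl in Hloc. intros H0. rewrite H0, Rabs_R0 in Hloc. lra.
Qed.

Theorem struve_quotient_expansion (nu : R) (h : nat -> R) (x : R) :
  - 1 / 2 <= nu ->
  (forall j, INR j + 1 <= h j) ->
  (forall x, is_lim_seq (prodn (fun j => 1 - x ^ 2 / h j ^ 2)) (calH nu x)) ->
  x <> 0 -> (forall n, x <> h n /\ x <> - h n) ->
  ex_series (fun n => 2 * x / (x ^ 2 - h n ^ 2)) /\
  struve_quotient nu x
  = (2 * nu + 1) / x + Series (fun n => 2 * x / (x ^ 2 - h n ^ 2)).
Proof.
  intros Hnu Hh HF Hx0 Hx. pose proof (calH_factor_pos nu Hnu) as HK.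
  destruct (product_is_derive (calH nu) h x Hh HF Hx) as [Hex HD].
  split; [exact Hex|]. set (S := Series _) in *.
  assert (Hne : calH nu x <> 0).
  { rewrite calH_hyp, hyp_even, <- calH_hyp by exact Hnu.
    apply product_neq_0 with h; try assumption; [apply Rabs_pos_lt, Hx0|].
    intros n E. destruct (Hx n) as [Hx1 Hx2].
    unfold Rabs in E. destruct (Rcase_abs x); [apply Hx2|apply Hx1]; lra. }
  assert (Eser : forall y, struve_series nu y = / calH_factor nu * calH nu y).
  { intros y. rewrite calH_struve_series. fold (calH_factor nu). field. lra. }
  set (D := PSeries (PS_derive (struve_coef nu)) ((x / 2) ^ 2) * (x / 2)).
  assert (H1 : is_derive (struve_series nu) x D).
  { apply is_derive_ext with (2 := is_derive_PSeries_half_sq _ x (struve_coef_radius nu Hnu)).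
    intros t. symmetry. apply struve_series_PSeries. }
  assert (H2 : is_derive (struve_series nu) x (/ calH_factor nu * (calH nu x * S))).
  { apply is_derive_ext with (fun y => / calH_factor nu * calH nu y).
    - intros t. symmetry. apply Eser.
    - apply (is_derive_scal (calH nu) x (/ calH_factor nu)), HD. }
  assert (ED : D = struve_series nu x * S).
  { rewrite <- (is_derive_unique _ _ _ H1), (is_derive_unique _ _ _ H2), Eser. ring. }
  assert (Hs : struve_series nu x <> 0).
  { rewrite Eser. apply Rmult_integral_contrapositive_currified; [|exact Hne].
    apply Rinv_neq_0_compat. lra. }
  rewrite struve_quotient_series, struve_series_pred by exact Hnu.
  fold D. rewrite ED. field. split; assumption.
Qed.

(** The partial products increase and are bounded by the exponential of a convergent
    sum. *)
Lemma inf_prod_abs_cv_of_bound (h : nat -> R) (x : R) :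
  (forall j, INR j + 1 <= h j) -> inf_prod_abs_cv (fun n => - (x ^ 2 / h n ^ 2)).
Proof.
  intros Hh. set (b := fun k => x ^ 2 * / (INR k + 1) ^ 2).
  assert (Hy : forall k, 0 <= x ^ 2 / h k ^ 2 <= b k)
    by (intros k; apply factor_bound; [exact Hh|lra]).
  set (u := fun n => 1 + Rabs (- (x ^ 2 / h n ^ 2))).
  assert (Hu : forall n, u n = 1 - - (x ^ 2 / h n ^ 2)).
  { intros n. unfold u. rewrite Rabs_Ropp, Rabs_pos_eq by apply Hy. ring. }
  destruct (ex_finite_lim_seq_incr (prodn u) (exp (Series b))) as [l Hl].
  - assert (H1 : forall n, 0 <= prodn u n).
    { induction n as [|n IH]; simpl; [lra|]. rewrite Hu. specialize (Hy n).
      apply Rmult_le_pos; lra. }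
    intros n. simpl. rewrite Hu. specialize (H1 n). specialize (Hy n). nra.
  - intros n. rewrite (prodn_ext u (fun k => 1 - - (x ^ 2 / h k ^ 2))) by (intros; apply Hu).
    apply Rle_trans with (1 := Rle_abs _).
    apply Rle_trans with (exp (sumn b n)).
    + apply prodn_bound. intros k _. rewrite Rabs_Ropp, Rabs_pos_eq; apply Hy.
    + apply exp_le_mono, sumn_le_Series.
      * intros k. apply scaled_inv_sq_pos, pow2_ge_0.
      * apply ex_series_scaled_inv_sq.
  - exists l. unfold is_inf_prod. apply is_lim_seq_incr_1 in Hl.
    apply is_lim_seq_ext with (2 := Hl). intros n. symmetry. apply prod_f_R0_prodn.
Qed.
Theorem lemma1 :
  forall nu : R, Rabs nu <= 1 / 2 ->
    (forall x : R, ex_series (calH_term nu x)) /\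
    (forall x : R, calH nu x <= 1) /\
    (forall x : R, 0 < x ->
       calH nu x = sqrt PI * Rpower 2 nu * Rpower x (- nu - 1)
                   * Gamma (nu + 3 / 2) * struve nu x) /\
    (exists h : nat -> R, positive_zeros (struve nu) h) /\
    (forall h : nat -> R, positive_zeros (struve nu) h ->
       (forall x : R,
          is_inf_prod (fun n => 1 - x ^ 2 / h n ^ 2) (calH nu x)) /\
       (forall x : R, inf_prod_abs_cv (fun n => - (x ^ 2 / h n ^ 2))) /\
       (forall x : R, x <> 0 -> (forall n, x <> h n /\ x <> - h n) ->
          ex_series (fun n => 2 * x / (x ^ 2 - h n ^ 2)) /\
          struve_quotient nu x
          = (2 * nu + 1) / x + Series (fun n => 2 * x / (x ^ 2 - h n ^ 2)))).
Proof.
  intros nu Hnu.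
  assert (Hnu2 : - 1 / 2 <= nu <= 1 / 2) by (apply Rabs_le_between in Hnu; lra).
  assert (Hlow : - 1 / 2 <= nu) by lra.
  destruct (hyp_factorization (nu + 1 / 2)) as (h & Hinc & Hh & HF); [lra|].
  assert (HF' : forall x, is_lim_seq (prodn (fun j => 1 - x ^ 2 / h j ^ 2)) (calH nu x)).
  { intros x. rewrite calH_hyp by exact Hlow. apply HF. }
  assert (Hz : positive_zeros (struve nu) h) by (apply positive_zeros_of_product; assumption).
  split; [intros x; apply ex_series_calH_term, Hlow|].
  split; [intros x; rewrite calH_hyp by exact Hlow; apply hyp_le_1; lra|].
  split; [intros x Hx; apply calH_struve, Hx|].
  split; [exists h; exact Hz|].
  intros g Hg.
  assert (E : forall n, g n = h n) by (apply (positive_zeros_unique (struve nu)); assumption).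
  assert (Hgl : forall j, INR j + 1 <= g j) by (intros j; rewrite E; apply Hh).
  assert (HG : forall x, is_lim_seq (prodn (fun j => 1 - x ^ 2 / g j ^ 2)) (calH nu x)).
  { intros x. apply is_lim_seq_ext with (2 := HF' x). intros n.
    apply prodn_ext. intros k _. rewrite E. reflexivity. }
  split; [|split].
  - intros x. apply is_lim_seq_ext with (2 := proj1 (is_lim_seq_incr_1 _ _) (HG x)).
    intros n. symmetry. apply prod_f_R0_prodn.
  - intros x. apply inf_prod_abs_cv_of_bound, Hgl.
  - intros x Hx0 Hx. apply struve_quotient_expansion; assumption.
Qed.
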